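(* Let $\kappa, k\in\mathcal{S}_{-1}$ be a pair of associate Sonine kernels, i.e. $\kappa,k\in C_{-1,0}(0,+\infty)$ and $(\kappa*k)(t)=1$ for all $t>0$. For every function $f\in C_{-1}^1(0,+\infty)$, the general fractional derivative of Caputo type $$({}_*\mathbb{D}_{(k)}f)(t)=\frac{d}{dt}(k*f)(t)-f(0)\,k(t),\quad t>0,$$ exists in the usual sense and coincides with the algebraic general fractional derivative of $f$, that is, in the field $\mathcal{F}_{-1}$ of convolution quotients (where functions in $C_{-1}(0,+\infty)$ are identified with their images under the embedding $C_{-1}(0,+\infty)\hookrightarrow\mathcal{F}_{-1}$), $${}_*\mathbb{D}_{(k)}f=S_\kappa\cdot f-S_\kappa\cdot\{f(0)\}.$$
   Context: Functions are complex-valued (real-valued ones included). $C_{-1}(0,+\infty)$ is the space of functions $f$ on $(0,+\infty)$ of the form $f(t)=t^{p-1}f_1(t)$, $t>0$, for some $p>0$ and some $f_1\in C[0,+\infty)$. $C_{-1,0}(0,+\infty)$ is the set of functions of the form $f(t)=t^{p-1}f_1(t)$, $t>0$, with some $0<p<1$ and $f_1\in C[0,+\infty)$. For $m\in\mathbb{N}_0$, $f\in C_{-1}^m(0,+\infty)$ means $f^{(m)}\in C_{-1}(0,+\infty)$. For $m\ge 1$ a function $f\in C_{-1}^m(0,+\infty)$ has finite limits $f^{(j)}(0):=\lim_{t\to0+}f^{(j)}(t)$, $0\le j\le m-1$, and is identified with its continuous extension to $[0,+\infty)$, which lies in $C^{m-1}[0,+\infty)$. $(f*g)(t)=\int_0^t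 f(\tau)g(t-\tau)\,d\tau$ is the Laplace convolution, and $\kappa^n=\kappa*\cdots*\kappa$ ($n$ factors). With $+$ and $*$, $C_{-1}(0,+\infty)$ is a commutative ring $\mathcal{R}_{-1}$ without divisors of zero (and without unity). $\mathcal{S}_{-1}$ is the set of Sonine kernels occurring in pairs $\kappa,k\in C_{-1,0}(0,+\infty)$ with $(\kappa*k)(t)=1$ for $t>0$; $k$ and $\kappa$ are then called associate to each other. $\mathcal{F}_{-1}$ is the field of fractions (field of convolution quotients) of $\mathcal{R}_{-1}$: its elements are classes $\frac{f}{g}$ of pairs $(f,g)$, $f,g\in C_{-1}(0,+\infty)$, $g\not\equiv0$, under $(f_1,g_1)\sim(f_2,g_2)\Leftrightarrow f_1*g_2=f_2*g_1$, with $\frac{f_1}{g_1}+\frac{f_2}{g_2}=\frac{f_1*g_2+f_2*g_1}{g_1*g_2}$ and $\frac{f_1}{g_1}\cdot\frac{f_2}{g_2}=\frac{f_1*f_2}{g_1*g_2}$. The ring $\mathcal{R}_{-1}$ is embedded in $\mathcal{F}_{-1}$ by $f\mapsto\frac{f*\kappa}{\kappa}$. The element $S_\kappa:=\frac{\kappa}{\kappa^2}\in\mathcal{F}_{-1}$ is the multiplicative inverse of $\kappa$ in $\mathcal{F}_{-1}$. For a number $a$, $\{a\}$ denotes the constant function equal to $a$ (an element of $\mathcal{R}_{-1}$). For $f\in C[0,+\infty)$ the algebraic general fractional derivative of Caputo type is the element $S_\kappa\cdot f-S_\kappa\cdot\{f(0)\}$ of $\mathcal{F}_{-1}$. *)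

(* Defs.v *)
From HB Require Import structures.
From mathcomp Require Import all_boot all_order all_algebra.
From mathcomp Require Import complex.
From mathcomp Require Import all_classical all_reals all_analysis.
Set Implicit Arguments.
Unset Strict Implicit.
Unset Printing Implicit Defensive.
Import Order.TTheory GRing.Theory Num.Theory.
Import numFieldNormedType.Exports.
Local Open Scope classical_set_scope.
Local Open Scope ring_scope.
Local Open Scope complex_scope.

(* A function on (0, +oo) is represented by a function on the whole line whose
   values at t <= 0 are irrelevant: every notion below only looks at t > 0. *)
Section Functions.
Variable R : realType.
Implicit Types (f g k : R -> R[i]) (p t : R) (D : set R).

(* R[i] carries no topology or measure in the libraries, so the analysis of
   complex-valued functions of a real variable is done componentwise. *)
Definition repart f : R -> R := fun t => complex.Re (f t).
Definition impart f : R -> R := fun t => complex.Im (f t).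

Definition ccontinuous_on D f :=
  {within D, continuous (repart f)} /\ {within D, continuous (impart f)}.

Definition cderivable f t :=
  derivable (repart f) t 1 /\ derivable (impart f) t 1.

Definition cderive f : R -> R[i] :=
  fun t => derive1 (repart f) t +i* derive1 (impart f) t.

Definition cintegrable D f :=
  (@lebesgue_measure R).-integrable D (EFin \o repart f) /\
  (@lebesgue_measure R).-integrable D (EFin \o impart f).

Definition cintegral D f : R[i] :=
  Rintegral (@lebesgue_measure R) D (repart f) +i*
  Rintegral (@lebesgue_measure R) D (impart f).

Definition has_limit0 f :=
  cvg (repart f t @[t --> 0^'+]) /\ cvg (impart f t @[t --> 0^'+]).

(* f(0) := lim_(t -> 0+) f(t) *)
Definition limit0 f : R[i] :=
  lim (repart f t @[t --> 0^'+]) +i* lim (impart f t @[t --> 0^'+]).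

Definition eq_pos f g := forall t, 0 < t -> f t = g t.

Definition power_times_continuous p f :=
  exists2 f1 : R -> R[i], ccontinuous_on `[0, +oo[ f1 &
    forall t, 0 < t -> f t = (t `^ (p - 1))%:C * f1 t.

(* C_{-1}(0,+oo) *)
Definition Cm1 f := exists2 p, 0 < p & power_times_continuous p f.

(* C_{-1,0}(0,+oo) *)
Definition Cm10 f := exists2 p, 0 < p < 1 & power_times_continuous p f.

(* C_{-1}^m(0,+oo): the derivative of order m exists on (0,+oo) and belongs to
   C_{-1}(0,+oo). *)
Fixpoint Cm1_der (m : nat) f : Prop :=
  if m is m'.+1 then (forall t, 0 < t -> cderivable f t) /\
                     Cm1_der m' (cderive f)
  else Cm1 f.

(* Laplace convolution *)
Definition lconv f g : R -> R[i] :=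
  fun t => cintegral `]0, t[ (fun tau => f tau * g (t - tau)).

Definition Sonine_pair kappa k :=
  [/\ Cm10 kappa, Cm10 k & forall t, 0 < t -> lconv kappa k t = 1].

Definition caputo k f : R -> R[i] :=
  fun t => cderive (lconv k f) t - limit0 f * k t.

(* The limits, integrals and derivatives entering [caputo k f] are total
   operators; this says that they are all genuine on (0, +oo). *)
Definition caputo_exists k f :=
  has_limit0 f /\
  forall t, 0 < t ->
    cintegrable `]0, t[ (fun tau => k tau * f (t - tau)) /\
    cderivable (lconv k f) t.

End Functions.

(* The field F_{-1} of convolution quotients: its elements are the equivalence
   classes of fractions (numerator, denominator). *)
Section Quotients.
Variable R : realType.
Local Notation fn := (R -> R[i]).
Local Notation frac := (fn * fn)%type.
Implicit Types (p q : frac) (P Q : set frac) (kappa f : fn) (a : R[i]).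

Definition is_frac p :=
  [/\ Cm1 p.1, Cm1 p.2 & ~ eq_pos p.2 (fun=> 0)].

Definition frac_equiv p q := eq_pos (lconv p.1 q.2) (lconv q.1 p.2).

Definition frac_class p : set frac :=
  [set q | is_frac q /\ frac_equiv q p].

Definition Fm1 : set (set frac) :=
  [set P | exists2 p, is_frac p & P = frac_class p].

Definition frac_add p q : frac :=
  ((fun t => lconv p.1 q.2 t + lconv q.1 p.2 t), lconv p.2 q.2).

Definition frac_opp p : frac := ((fun t => - p.1 t), p.2).

Definition frac_mul p q : frac := (lconv p.1 q.1, lconv p.2 q.2).

(* Operations on classes are induced by those on representatives. As C_{-1} has
   no divisors of zero, the class of the result does not depend on the chosen
   representatives; the intersection over all choices is this common class. *)
Definition Fadd P Q : set frac :=
  \bigcap_(p in P) \bigcap_(q in Q) frac_class (frac_add p q).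

Definition Fopp P : set frac := \bigcap_(p in P) frac_class (frac_opp p).

Definition Fmul P Q : set frac :=
  \bigcap_(p in P) \bigcap_(q in Q) frac_class (frac_mul p q).

Definition Fsub P Q : set frac := Fadd P (Fopp Q).

(* The embedding of C_{-1} into F_{-1}; it does not depend on kappa. *)
Definition embed kappa f : set frac := frac_class (lconv f kappa, kappa).

(* S_kappa, the inverse of kappa in F_{-1} *)
Definition Sinv kappa : set frac := frac_class (kappa, lconv kappa kappa).

Definition alg_caputo kappa f : set frac :=
  Fsub (Fmul (Sinv kappa) (embed kappa f))
       (Fmul (Sinv kappa) (embed kappa (fun=> limit0 f))).

End Quotients.

(* Main.v *)
(* With g = f' one has f = f(0) + 1 * g, hence k * f = 1 * (f(0) k + k * g), so
   that the Caputo derivative is k * g; as kappa * k = 1, it equals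
   S_kappa (f - f(0)) in the field of quotients.

   The operations of the field being intersections over all representatives,
   computing with them requires the absence of divisors of zero, i.e. the
   theorem of Titchmarsh for the half line, proved along the lines of
   Mikusinski and Ryll-Nardzewski.  If f * f = 0, the square of the Laplace
   transform of f truncated at 2T is O(exp (- 2nT)), so that the integrals of
   exp (n (T - x)) f x over ]0, T[ stay bounded as n grows, which forces f = 0
   on ]0, T[ (Phragmen).  If f * g = 0, then f * (t g) has square 0 since
   multiplication by t is a derivation; hence f * ((1 + t) ^ n g) = 0 for all n,
   and the same moment argument yields f x g (T - x) = 0 for all x < T. *)
Require Import Defs.
From HB Require Import structures.
From mathcomp Require Import all_boot all_order all_algebra.
From mathcomp Require Import complex.
From mathcomp Require Import all_classical all_reals all_analysis.
From mathcomp Require Import measurable_realfun ring lra.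
Set Implicit Arguments.
Unset Strict Implicit.
Unset Printing Implicit Defensive.
Import Order.TTheory GRing.Theory Num.Theory.
Import numFieldNormedType.Exports.
Local Open Scope classical_set_scope.
Local Open Scope ring_scope.

(** * Affine substitutions for the Lebesgue measure *)

(** Complex values are the main obstacle. If [u = f + i g] has square zero, one only knows
    [f * f = g * g] and [f * g = 0]; the transforms [A] of [f] and [B] of [g] are then bounded
    together through [(A^2 + B^2)^2 = (A^2 - B^2)^2 + 4 (A B)^2]. Truncating at [2T] leaves an error
    [exp (- 2nT)] in the square, so that its square root has the order [exp (- nT)] needed for the
    moments over []0, T[]. Phragmen's argument is carried out for any bounded decreasing weight
    [phi > 1]: the inequality [phi > 1] is what makes the coefficients of the approximating
    polynomials small. It serves for [exp (T - x)] and for [1 + (T - x)]; the latter is why powers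
    of [1 + t], not of [t], are multiplied into [g]. Convolution has no unit, so functions are
    mapped into a complexified unital commutative ring in which identities between fractions become
    polynomial identities. Cancellation there is used only for elements that come from functions. *)

Section Substitution.
Context {R : realType}.
Local Notation mu := (@lebesgue_measure R).

Lemma measurable_subl (t : R) : measurable_fun [set: R] (fun x : R => t - x).
Proof. exact: measurable_funB. Qed.

(** Uniqueness of Lebesgue measure reduces this to intervals []a, b]], whose preimage [[t - b, t -
    a[] has the same length. *)
Lemma pushforward_subl (t : R) (A : set R) : measurable A ->
  pushforward mu ((fun x => t - x) : R -> measurableTypeR R) A = mu A.
Proof.
move=> mA; apply/esym.
apply: (@lebesgue_measure_unique R
  (pushforward mu ((fun x => t - x) : R -> measurableTypeR R))) => [|mm _ [[a b]] _ <-|//].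
  exact: measurable_subl.
transitivity (mu `[t - b, t - a[); last first.
  congr (mu _); apply/seteqP; split => x /=; rewrite !in_itv/= => /andP[? ?];
  by apply/andP; split; lra.
rewrite !lebesgue_measure_itv/= !lte_fin.
have -> : (t - b < t - a) = (a < b) by apply/idP/idP; lra.
by case: ifP => // _; rewrite -!EFinB; congr EFin; ring.
Qed.

(** Positive and negative parts are treated separately, so that measurability suffices and no
    integrability has to be carried along. *)
Lemma integral_subl (t : R) (h : R -> \bar R) : measurable_fun [set: R] h ->
  (\int[mu]_x h (t - x)%R = \int[mu]_x h x)%E.
Proof.
move=> mh.
have pos (k : R -> \bar R) : measurable_fun [set: R] k -> (forall x, 0 <= k x)%E ->
    (\int[mu]_x k (t - x)%R = \int[mu]_x k x)%E.
  move=> mk k0.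
  rewrite -[RHS](@eq_measure_integral _ _ _ _ _
    (pushforward mu ((fun x => t - x) : R -> measurableTypeR R))); last first.
    by move=> mm A mA _ /=; exact: pushforward_subl.
    by move=> mm; rewrite ge0_integral_pushforward.
  exact: measurable_subl.
rewrite [LHS]integralE [RHS]integralE.
congr (_ - _)%E.
  rewrite -(pos h^\+%E (measurable_funepos mh))//.
  by apply: eq_integral => x _; rewrite !funeposE.
rewrite -(pos h^\-%E (measurable_funeneg mh))//.
by apply: eq_integral => x _; rewrite !funenegE.
Qed.

Lemma Rintegral_subl (t : R) (h : R -> R) : measurable_fun [set: R] h ->
  \int[mu]_x h (t - x) = \int[mu]_x h x.
Proof.
by move=> mh; congr fine; apply: (@integral_subl t (EFin \o h)); exact/measurable_EFinP.
Qed.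

Lemma integrable_subl (t : R) (h : R -> R) :
  mu.-integrable setT (EFin \o h) ->
  mu.-integrable setT (EFin \o (fun x => h (t - x))).
Proof.
move=> /integrableP[mh ih]; apply/integrableP; split.
  apply/measurable_EFinP.
  by apply: measurableT_comp; [exact/measurable_EFinP|exact: measurable_subl].
by rewrite (@integral_subl t (fun x => `|(h x)%:E|%E))//; exact: measurableT_comp.
Qed.

(** A translation is the composite of two reflections. *)
Lemma integral_shift (t : R) (h : R -> \bar R) : measurable_fun [set: R] h ->
  (\int[mu]_x h (x - t)%R = \int[mu]_x h x)%E.
Proof.
move=> mh; rewrite -(@integral_subl 0 h)// -(@integral_subl t (fun x => h (0 - x)%R)).
  by apply: eq_integral => x _; congr h; ring.
by apply: measurableT_comp => //; exact: measurable_subl.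
Qed.

Lemma integrable_shift (t : R) (h : R -> R) :
  mu.-integrable setT (EFin \o h) ->
  mu.-integrable setT (EFin \o (fun x => h (x - t))).
Proof.
move=> /(@integrable_subl 0)/(@integrable_subl t).
by apply: eq_integrable => // x _ /=; congr (h _)%:E; ring.
Qed.

Lemma Rintegral_scale (c : R) (h : R -> R) : 0 < c -> measurable_fun [set: R] h ->
  \int[mu]_x h x = c * \int[mu]_x h (c * x).
Proof.
move=> c0 mh.
have mc : measurable_fun [set: R] (fun x : R => c * x) by exact: mulrl_measurable.
have cE : (0 <= c)%R by exact: ltW.
pose cn : {nonneg R} := NngNum cE.
have key A : measurable A ->
   mu A = mscale cn (pushforward mu ((fun x => c * x) : R -> measurableTypeR R)) A.
  apply: (@lebesgue_measure_unique R
   (mscale cn (pushforward mu ((fun x => c * x) : R -> measurableTypeR R)))) => // _ [[a b]] _ <-.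
  rewrite /mscale /pushforward.
  transitivity (c%:E * mu `](c^-1 * a)%R, (c^-1 * b)%R])%E; last first.
    by congr (_ * mu _)%E; apply/seteqP; split => x /=; rewrite !in_itv/= ltr_pdivrMl// ler_pdivlMl.
  rewrite !lebesgue_measure_itv/= !lte_fin ltr_pM2l ?invr_gt0//.
  case: ifP => // _; last by rewrite mule0.
  by rewrite -!EFinB -EFinM -mulrBr mulrA divff ?mul1r// gt_eqF.
have pos (k : R -> \bar R) : measurable_fun [set: R] k -> (forall x, 0 <= k x)%E ->
    (\int[mu]_x k x = c%:E * \int[mu]_x k (c * x)%R)%E.
  move=> mk k0.
  rewrite (@eq_measure_integral _ _ _ _ (mscale cn
    (pushforward mu ((fun x => c * x) : R -> measurableTypeR R)))); last first.
    by move=> A mA _ /=; exact: key.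
  rewrite ge0_integral_mscale//; congr (_ * _)%E.
  by rewrite ge0_integral_pushforward.
rewrite /Rintegral.
have mhE : measurable_fun [set: R] (EFin \o h) by exact/measurable_EFinP.
suff -> : (\int[mu]_x (h x)%:E = c%:E * \int[mu]_x (h (c * x))%:E)%E.
  (* If the integral is infinite, so is the other one, and [fine] sends both to [0]. *)
  have [fi|] := boolP ((\int[mu]_x (h (c * x))%:E)%E \is a fin_num).
    by rewrite fineM.
  rewrite fin_numE negb_and !negbK => /orP[] /eqP ->.
    by rewrite gt0_muleNy ?lte_fin//= mulr0.
  by rewrite gt0_muley ?lte_fin//= mulr0.
rewrite [LHS]integralE (pos _ (measurable_funepos mhE))// (pos _ (measurable_funeneg mhE))//.
rewrite [in RHS]integralE.
set u := (X in (c%:E * X - _)%E); set v := (X in (_ - c%:E * X)%E).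
have u0 : (0 <= u)%E by exact: integral_ge0.
have v0 : (0 <= v)%E by exact: integral_ge0.
transitivity (c%:E * (u - v))%E; last first.
  congr (_ * (_ - _))%E; apply: eq_integral => x _; first by rewrite !funeposE.
  by rewrite !funenegE.
(* Distributivity over a difference of possibly infinite terms is checked case by case. *)
case: u u0 => [u| |] // u0; case: v v0 => [v| |] // v0.
- exact: (congr1 EFin (esym (mulrBr c u v))).
- by rewrite gt0_muley ?lte_fin//= gt0_muleNy ?lte_fin.
- by rewrite gt0_muley ?lte_fin.
- by rewrite gt0_muley ?lte_fin//= gt0_muleNy ?lte_fin.
Qed.

End Substitution.

(** * Integrability of powers at the origin *)

Section PowerIntegrable.
Context {R : realType}.
Local Notation mu := (@lebesgue_measure R).

Lemma integral_segment_FTC (f F : R -> R) (a b : R) : a < b ->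
  (forall x, x \in `[a, b] -> {for x, continuous f}) ->
  (forall x, x \in `[a, b] -> is_derive x (1 : R) F (f x)) ->
  (\int[mu]_(x in `[a, b]) (f x)%:E = (F b - F a)%:E)%E.
Proof.
move=> ab cf dF.
have cF x : x \in `[a, b] -> {for x, continuous F}.
  move=> /dF [dFx _]; apply: differentiable_continuous; exact/derivable1_diffP.
rewrite (continuous_FTC2 ab (F := F))//.
- by apply: continuous_in_subspaceT => x; rewrite inE => /cf.
- split.
  + by move=> x /subset_itv_oo_cc/dF[].
  + by apply: cvg_at_right_filter; apply: cF; rewrite in_itv/= lexx ltW.
  + by apply: cvg_at_left_filter; apply: cF; rewrite in_itv/= lexx ltW.
- by move=> x /subset_itv_oo_cc/dF dFx; rewrite derive1E derive_val.
Qed.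

Lemma continuous_powR (p x : R) : 0 < x -> {for x, continuous (fun y => y `^ p)}.
Proof.
move=> x0; apply: differentiable_continuous; apply/derivable1_diffP.
by have [] := is_derive1_powR p x0.
Qed.

(** Monotone convergence along segments exhausting []0, T]]: on each of them the antiderivative
    [x ^ p / p] bounds the integral by [T ^ p / p]. *)
Lemma integrable_powR (p T : R) : 0 < p ->
  mu.-integrable `]0, T[ (EFin \o (fun x => x `^ (p - 1))).
Proof.
move=> p0.
have [T0|T0] := leP T 0.
  by rewrite set_itv_ge ?bnd_simp -?leNgt//; exact: integrable_set0.
(* The shift by two gives [a n < T] already for [n = 0], so no segment is degenerate. *)
pose a (n : nat) : R := T / n.+2%:R.
have a0 n : 0 < a n by rewrite divr_gt0.
have aT n : a n < T.
  by rewrite ltr_pdivrMr// ltr_pMr// ltr1n.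
pose F (n : nat) : set R := `[a n, T]%classic.
pose g x : R := x `^ (p - 1).
have mg (D : set (measurableTypeR R)) : measurable_fun D (EFin \o g).
  by apply/measurable_EFinP; apply: measurable_funTS; exact: measurable_powR.
have ndF : nondecreasing_seq F.
  move=> m n mn; apply/subsetPset => x; rewrite /F/= !in_itv/= => /andP[ax ->].
  rewrite andbT (le_trans _ ax)// ler_pM2l// lef_pV2 ?posrE// ler_nat.
  by rewrite !ltnS.
have mF n : measurable (F n : set (measurableTypeR R)) by exact: measurable_itv.
have g0 x : (0 <= (EFin \o g) x)%E by rewrite lee_fin powR_ge0.
apply: (@integrableS _ _ _ mu (\bigcup_n F n)) => //.
- by apply: bigcup_measurable => n _; exact: mF.
- move=> x /=; rewrite in_itv/= => /andP[x0 xT].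
  have [n nx] : exists n : nat, T / x < n%:R.
    exists (Num.Def.trunc (T / x)).+1.
    by have /andP[] := trunc_itv (divr_ge0 (ltW T0) (ltW x0)).
  exists n => //; rewrite /F/= in_itv/= (ltW xT) andbT.
  rewrite ler_pdivrMr// mulrC -ler_pdivrMr//.
  by rewrite (le_trans (ltW nx))// ler_nat -addn2 leq_addr.
apply/integrableP; split; first exact: mg.
under eq_integral => x _ do rewrite gee0_abs ?g0//.
have := @ge0_nondecreasing_set_cvg_integral _ (measurableTypeR R) R F (EFin \o g) mu ndF mF.
move=> /(_ (fun=> mg _) (fun n x _ => g0 x)) cv.
rewrite -(cvg_lim _ cv)//.
apply: (@le_lt_trans _ _ (T `^ p / p)%:E); last exact: ltry.
apply: lime_le; first by apply/cvg_ex; eexists; exact: cv.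
apply: nearW => n.
pose G x : R := p^-1 *: x `^ p.
have -> : (\int[mu]_(x in F n) (EFin \o g) x = (G T - G (a n))%:E)%E.
  apply: (@integral_segment_FTC g G) => //.
  - move=> x; rewrite in_itv/= => /andP[ax _].
    by apply: continuous_powR; exact: lt_le_trans ax.
  - move=> x; rewrite in_itv/= => /andP[ax _].
    have x0 : 0 < x by exact: lt_le_trans ax.
    have dx := is_derive1_powR p x0.
    apply: is_derive_eq.
    by rewrite /GRing.scale/= mulrA mulVf ?mul1r// gt_eqF.
rewrite lee_fin /G /GRing.scale/= lerBlDr mulrC lerDl mulr_ge0//.
- by rewrite invr_ge0 ltW.
- exact: powR_ge0.
Qed.

End PowerIntegrable.

(** * Functions t ^ (p - 1) f1 t on the half line *)

Section Causal.
Context {R : realType}.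
Local Notation mu := (@lebesgue_measure R).
Implicit Types f g h : R -> R.

Lemma integrable_mull (D : set R) (k : R) f : measurable (D : set (measurableTypeR R)) ->
  mu.-integrable D (EFin \o f) -> mu.-integrable D (EFin \o (fun x => k * f x)).
Proof. by move=> mD fi; exact: (@integrableZl _ _ _ mu D mD k (EFin \o f) fi). Qed.

Lemma integrable_add (D : set R) f g : measurable (D : set (measurableTypeR R)) ->
  mu.-integrable D (EFin \o f) -> mu.-integrable D (EFin \o g) ->
  mu.-integrable D (EFin \o (fun x => f x + g x)).
Proof.
by move=> mD fi gi; exact: (@integrableD _ _ _ mu D mD (EFin \o f) (EFin \o g)).
Qed.

Lemma integrable_sub (D : set R) f g : measurable (D : set (measurableTypeR R)) ->
  mu.-integrable D (EFin \o f) -> mu.-integrable D (EFin \o g) ->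
  mu.-integrable D (EFin \o (fun x => f x - g x)).
Proof.
by move=> mD fi gi; exact: (@integrableB _ _ _ mu D mD (EFin \o f) (EFin \o g)).
Qed.

Definition pw (p : R) (f1 : R -> R) : R -> R :=
  fun t => if 0 < t then t `^ (p - 1) * f1 t else 0.

(** The value is prescribed as [0] on [t <= 0]: equality of causal functions is plain equality, and
    the integral over the whole line in [conv] is the Laplace convolution. *)
Definition causal f :=
  exists p f1, [/\ 0 < p, continuous f1 & f = pw p f1].

Definition conv f g : R -> R := fun t => \int[mu]_x (f x * g (t - x)).

Definition cut (T : R) f : R -> R := fun x => if x < T then f x else 0.

Lemma causal_le0 f t : causal f -> t <= 0 -> f t = 0.
Proof. by move=> [p [f1 [_ _ ->]]] t0; rewrite /pw ltNge t0. Qed.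

Lemma measurable_causal f : causal f -> measurable_fun [set: R] f.
Proof.
move=> [p [f1 [_ cf ->]]]; apply: measurable_fun_ifT => //.
- exact: measurable_fun_ltr.
- apply: measurable_funM; first exact: measurable_powR.
  exact: continuous_measurable_fun.
Qed.

Lemma continuous_bounded_itv f (a b : R) : continuous f ->
  exists2 M, 0 <= M & forall x, x \in `[a, b] -> `|f x| <= M.
Proof.
move=> cf.
have : bounded_set (f @` `[a, b]).
  apply: compact_bounded; apply: continuous_compact; last exact: segment_compact.
  exact: continuous_subspaceT.
move=> [M [_ HM]]; exists (`|M| + 1) => [|x xab]; first by rewrite addr_ge0.
apply: HM; first by rewrite (le_lt_trans (ler_norm M))// ltrDl.
by exists x.
Qed.

Lemma causal_dom f (T : R) : causal f -> exists (p M : R), [/\ 0 < p, 0 <= M &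
  forall t, 0 < t -> t <= T -> `|f t| <= M * t `^ (p - 1)].
Proof.
move=> [p [f1 [p0 cf ->]]].
have [M M0 HM] := continuous_bounded_itv 0 T cf.
exists p, M; split => // t t0 tT; rewrite /pw t0 normrM mulrC (ger0_norm (powR_ge0 _ _)).
apply: ler_wpM2r; first exact: powR_ge0.
by apply: HM; rewrite in_itv/= (ltW t0).
Qed.

Lemma causal_continuous f t : causal f -> 0 < t -> {for t, continuous f}.
Proof.
move=> [p [f1 [p0 cf ->]]] t0.
have : {for t, continuous (fun t => t `^ (p - 1) * f1 t)}.
  by apply: continuousM; [exact: continuous_powR|exact: cf].
rewrite /prop_for /continuous_at /pw t0.
apply: cvg_trans; apply: near_eq_cvg.
near=> x.
suff -> : 0 < x by [].
by near: x; exact: lt_nbhsr.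
Unshelve. all: by end_near. Qed.

Lemma causal_bounded f (a T : R) : causal f -> 0 < a ->
  exists2 M, 0 <= M & forall t, a <= t -> t <= T -> `|f t| <= M.
Proof.
move=> cf a0.
have [p [M [p0 M0 HM]]] := causal_dom T cf.
(* The power is monotone, so its maximum sits at an endpoint; the sign of [p - 1] decides which. *)
exists (M * (Num.max (a `^ (p - 1)) (T `^ (p - 1)))) => [|t at_ tT].
  by rewrite mulr_ge0// le_max powR_ge0.
have t0 : 0 < t by exact: lt_le_trans at_.
rewrite (le_trans (HM t t0 tT))// ler_wpM2l// le_max.
have [p1|p1] := leP p 1; apply/orP; [left|right].
  rewrite -[p - 1]opprB !powRN lef_pV2 ?posrE ?powR_gt0//.
  by apply: ge0_ler_powR; rewrite ?nnegrE ?subr_ge0// ltW.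
by apply: ge0_ler_powR; rewrite ?nnegrE ?subr_ge0// ltW// (lt_le_trans t0).
Qed.

Lemma integrable_causal f (T : R) : causal f ->
  mu.-integrable `]0, T[ (EFin \o f).
Proof.
move=> cf.
have [p [M [p0 M0 HM]]] := causal_dom T cf.
apply: (@le_integrable _ _ _ mu _ _ _ (EFin \o (fun x => M * x `^ (p - 1)))) => //.
- by apply/measurable_EFinP; apply: measurable_funTS; exact: measurable_causal.
- move=> x /=; rewrite in_itv/= => /andP[x0 xT].
  by rewrite lee_fin (le_trans (HM x x0 (ltW xT)))// ler_norm.
- by apply: integrable_mull => //; exact: integrable_powR.
Qed.

Lemma cut_causalE f T : causal f -> cut T f = f \_ `]0, T[.
Proof.
move=> cf; apply/funext => x; rewrite patchE /cut.
have [x0|x0] := leP x 0.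
  by rewrite (causal_le0 cf x0) if_same memNset//= in_itv/= ltNge x0.
have [xT|xT] := ltP x T; first by rewrite mem_set//= in_itv/= x0.
by rewrite memNset//= in_itv/= x0/= ltNge xT.
Qed.

Lemma integrable_cut f T : causal f -> mu.-integrable [set: R] (EFin \o cut T f).
Proof.
move=> cf; rewrite cut_causalE// -restrict_EFin.
apply: (integrable_mkcond _ _).1 => //; exact: integrable_causal.
Qed.

(* On each half of ]0, t[ one of the two factors is bounded. *)
Lemma integrable_convolution f g t : causal f -> causal g ->
  mu.-integrable [set: R] (EFin \o (fun x => f x * g (t - x))).
Proof.
move=> cf cg.
have mfg : measurable_fun [set: R] (fun x => f x * g (t - x)).
  apply: measurable_funM; first exact: measurable_causal.
  by apply: measurableT_comp; [exact: measurable_causal|exact: measurable_subl].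
have [t0|t0] := leP t 0.
  apply: (eq_integrable _ (cst 0%E)) => //; last exact: integrable0.
  move=> x _ /=; congr EFin.
  have [x0|x0] := leP x 0; first by rewrite (causal_le0 cf)// mul0r.
  by rewrite (causal_le0 cg) ?mulr0//; lra.
have t2 : 0 < t / 2 by rewrite divr_gt0.
have [Mf Mf0 HMf] := causal_bounded t cf t2.
have [Mg Mg0 HMg] := causal_bounded t cg t2.
have Ic := integrable_cut t cf.
have Id := integrable_subl t (integrable_cut t cg).
apply: (@le_integrable _ _ _ mu _ _ _
  (EFin \o (fun x => Mg * `|cut t f x| + Mf * `|cut t g (t - x)|))) => //.
- exact/measurable_EFinP.
- move=> x _ /=; rewrite lee_fin [leRHS]ger0_norm; last first.
    by rewrite addr_ge0// mulr_ge0.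
  have [x0|x0] := leP x 0.
    by rewrite (causal_le0 cf x0) mul0r normr0 addr_ge0// mulr_ge0.
  have [tx|xt] := leP t x.
    by rewrite (causal_le0 cg) ?mulr0 ?normr0 ?addr_ge0 ?mulr_ge0//; lra.
  rewrite normrM {1}/cut xt /cut.
  have -> : t - x < t by lra.
  have [x2|x2] := leP x (t / 2).
    rewrite (@le_trans _ _ (Mg * `|f x|))//; last by rewrite lerDl mulr_ge0.
    by rewrite mulrC ler_wpM2r// HMg//; lra.
  rewrite (@le_trans _ _ (Mf * `|g (t - x)|))//; last by rewrite lerDr mulr_ge0.
  by rewrite ler_wpM2r// HMf//; lra.
- apply: integrable_add => //.
    by apply: integrable_mull => //; exact: (integrable_norm Ic).
  by apply: integrable_mull => //; exact: (integrable_norm Id).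
Qed.

Lemma conv_le0 f g t : causal f -> causal g -> t <= 0 -> conv f g t = 0.
Proof.
move=> cf cg t0; rewrite /conv.
under eq_Rintegral => x _.
  rewrite (_ : f x * g (t - x) = 0); first over.
  have [x0|x0] := leP x 0; first by rewrite (causal_le0 cf)// mul0r.
  by rewrite (causal_le0 cg) ?mulr0//; lra.
by rewrite /Rintegral integral0.
Qed.

Lemma convC f g : causal f -> causal g -> conv f g = conv g f.
Proof.
move=> cf cg; apply/funext => t; rewrite /conv.
rewrite -(@Rintegral_subl _ t (fun x => g x * f (t - x))).
  by apply: eq_Rintegral => x _; rewrite mulrC; congr (_ * f _); ring.
apply: measurable_funM; first exact: measurable_causal.
by apply: measurableT_comp; [exact: measurable_causal|exact: measurable_subl].
Qed.

Lemma causal_norm f : causal f -> causal (fun t => `|f t|).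
Proof.
move=> [p [f1 [p0 cf ->]]]; exists p, (fun t => `|f1 t|); split => //.
  by move=> x; apply: cvg_norm; exact: cf.
apply/funext => t; rewrite /pw; case: ifP => _; last by rewrite normr0.
by rewrite normrM ger0_norm// powR_ge0.
Qed.

Lemma causal_opp f : causal f -> causal (fun t => - f t).
Proof.
move=> [p [f1 [p0 cf ->]]]; exists p, (fun t => - f1 t); split => //.
  by move=> x; apply: cvgN; exact: cf.
by apply/funext => t; rewrite /pw; case: ifP => _; rewrite ?oppr0// mulrN.
Qed.

Lemma causal_mulX f : causal f -> causal (fun t => t * f t).
Proof.
move=> [p [f1 [p0 cf ->]]]; exists p, (fun t => t * f1 t); split => //.
  by move=> x; apply: cvgM; [exact: cvg_id|exact: cf].
by apply/funext => t; rewrite /pw; case: ifP => _; rewrite ?mulr0// mulrCA.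
Qed.

Lemma continuous_maxr_powR (e : R) : 0 <= e ->
  continuous (fun t : R => (Num.max 0 t) `^ e).
Proof.
rewrite le_eqVlt => /predU1P[<-|e0] t.
  by under eq_fun do rewrite powRr0; exact: cvg_cst.
apply/cvgrPdist_lt => /= eps eps0.
have [t0|t0|->] := ltgtP t 0.
- near=> x; rewrite !max_l ?(ltW t0) ?subrr ?normr0//.
  by apply: ltW; near: x; exact: lt_nbhsl.
- have /cvgrPdist_lt/(_ _ eps0) := @continuous_powR R e t t0.
  move=> H; near=> x.
  rewrite max_r; first by near: x.
  by apply: ltW; near: x; exact: lt_nbhsr.
- rewrite powR0 ?gt_eqF//.
  near=> x; rewrite sub0r normrN ger0_norm ?powR_ge0//.
  have [x0|x0] := leP x 0; first by rewrite powR0// gt_eqF.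
  have en0 : e != 0 by rewrite gt_eqF.
  rewrite -[ltRHS](@powRr1 _ eps) ?ltW// -(mulVf en0) powRrM.
  apply: gt0_ltr_powR => //; rewrite ?nnegrE ?powR_ge0 ?ltW//.
  by near: x; apply: lt_nbhsl; rewrite powR_gt0.
Unshelve. all: by end_near. Qed.

(** An exponent can be lowered: the surplus [t ^ (q - p)] is absorbed into the continuous factor.
    This brings two functions to a common exponent, as sums require. *)
Lemma pw_le (p q : R) f1 : p <= q ->
  pw q f1 = pw p (fun t => (Num.max 0 t) `^ (q - p) * f1 t).
Proof.
move=> pq; apply/funext => t; rewrite /pw; case: ifP => // t0.
have tn0 : t != 0 by rewrite gt_eqF.
rewrite max_r ?(ltW t0)// mulrA -powRD ?tn0 ?implybT//.
by congr (_ `^ _ * _); ring.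
Qed.

Lemma causalD f g : causal f -> causal g -> causal (fun t => f t + g t).
Proof.
have key p q f1 g1 : 0 < p -> p <= q -> continuous f1 -> continuous g1 ->
    causal (fun t => pw p f1 t + pw q g1 t).
  move=> p0 pq cf cg; rewrite (pw_le _ pq).
  exists p, (fun t => f1 t + (Num.max 0 t) `^ (q - p) * g1 t); split => //.
    move=> x; apply: cvgD; first exact: cf.
    by apply: cvgM; [apply: continuous_maxr_powR; rewrite subr_ge0|exact: cg].
  by apply/funext => t; rewrite /pw; case: ifP => _; rewrite ?addr0// mulrDr.
move=> [p [f1 [p0 cf ->]]] [q [g1 [q0 cg ->]]].
have [pq|/ltW qp] := leP p q; first exact: key.
by under eq_fun do rewrite addrC; exact: key.
Qed.

End Causal.

(** * Convolution *)

Section Convolution.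
Context {R : realType}.
Local Notation mu := (@lebesgue_measure R).
Implicit Types f g h : R -> R.

(* Substituting [x = t s] factors out [t ^ (p + q - 1)] and leaves an integral
   against the fixed weight [s ^ (p - 1) (1 - s) ^ (q - 1)]. *)
Lemma conv_pw (p q : R) f1 g1 : 0 < p -> 0 < q -> continuous f1 -> continuous g1 ->
  exists2 h, continuous h & conv (pw p f1) (pw q g1) = pw (p + q) h.
Proof.
move=> p0 q0 cf1 cg1.
set f := pw p f1; set g := pw q g1.
have cf : causal f by exists p, f1.
have cg : causal g by exists q, g1.
have cpw (r : R) : 0 < r -> causal (pw r (fun=> 1)).
  by move=> r0; exists r, (fun=> 1); split => // x; exact: cvg_cst.
pose w s := pw p (fun=> 1) s * pw q (fun=> 1) (1 - s).
have iw : mu.-integrable [set: R] (EFin \o w) by apply: integrable_convolution; exact: cpw.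
have mw : measurable_fun [set: R] w by apply/measurable_EFinP; exact: measurable_int iw.
have w0 s : s \notin `[0, 1] -> w s = 0.
  rewrite in_itv/= negb_and -!ltNge /w /pw => /orP[s0|s1].
    by rewrite ltNge (ltW s0) mul0r.
  have -> : (0 < 1 - s) = false by apply/negbTE; rewrite -leNgt subr_le0 ltW.
  by rewrite mulr0.
(* Defined for every real [t], not only [t > 0], since the integral [H] must be continuous on the
   whole line. *)
pose F t s := w s * (f1 (t * s) * g1 (t * (1 - s))).
have mF t : measurable_fun [set: R] (F t).
  apply: measurable_funM => //; apply: measurable_funM.
    apply: measurableT_comp; first exact: continuous_measurable_fun.
    exact: mulrl_measurable.
  apply: measurableT_comp; first exact: continuous_measurable_fun.
  apply: measurableT_comp; first exact: mulrl_measurable.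
  exact: measurable_subl.
have bF (T : R) : exists2 M : R, 0 <= M & forall t s : R, `|t| <= T -> `|F t s| <= M * `|w s|.
  have [M M0 HM] := continuous_bounded_itv (- T) T cf1.
  have [N N0 HN] := continuous_bounded_itv (- T) T cg1.
  exists (M * N); first exact: mulr_ge0.
  move=> t s tT.
  have [|s01] := boolP (s \in `[0, 1]); last by rewrite /F w0// mul0r normr0 mulr0.
  rewrite in_itv/= => /andP[s0 s1].
  rewrite /F normrM mulrC ler_wpM2r// normrM ler_pM//.
    apply: HM; rewrite in_itv/= -ler_norml normrM (ger0_norm s0).
    by rewrite (le_trans _ tT)// ler_piMr.
  have s0' : 0 <= 1 - s by rewrite subr_ge0.
  apply: HN; rewrite in_itv/= -ler_norml normrM (ger0_norm s0').
  by rewrite (le_trans _ tT)// ler_piMr// gerBl.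
have iF t : mu.-integrable [set: R] (EFin \o F t).
  have [M M0 HM] := bF `|t|.
  apply: (@le_integrable _ _ _ mu _ _ _ (EFin \o (fun s => M * `|w s|))) => //.
  - by apply/measurable_EFinP; exact: mF.
  - by move=> s _ /=; rewrite lee_fin (le_trans (HM t s (lexx _)))// ler_norm.
  - by apply: integrable_mull => //; exact: (integrable_norm iw).
pose H t := \int[mu]_s F t s.
have cts (k : R -> R) (c : R) : continuous k -> continuous (fun x : R => k (x * c)).
  move=> ck x; apply: (@continuous_comp _ _ _ (fun x : R => x * c) k); last exact: ck.
  by apply: cvgM; [exact: cvg_id|exact: cvg_cst].
have cH : continuous H.
  move=> t.
  have [M M0 HM] := bF (`|t| + 1).
  apply: (@continuity_under_integral R _ _ mu F setT measurableT (- (`|t| + 1)) (`|t| + 1)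
    (fun x _ => iF x) _ (fun s => M * `|w s|)).
  - apply: aeW => s _ x _.
    apply: cvgM; first exact: cvg_cst.
    by apply: cvgM; [exact: (cts f1 s cf1 x)|exact: (cts g1 (1 - s) cg1 x)].
  - by apply: integrable_mull => //; exact: (integrable_norm iw).
  - move=> x; rewrite /= in_itv/= -ltr_norml => xt.
    by apply: aeW => s _; apply: HM; exact: ltW.
  - by rewrite inE/= in_itv/= -ltr_norml ltrDl.
exists H => //; apply/funext => t; rewrite /pw; case: ifPn => [t0|]; last first.
  by rewrite -leNgt => t0; exact: conv_le0.
have mfg : measurable_fun [set: R] (fun x => f x * g (t - x)).
  by apply/measurable_EFinP; apply: measurable_int (integrable_convolution t cf cg).
rewrite /conv (Rintegral_scale t0 mfg).
have E s : f (t * s) * g (t - t * s) = t `^ (p - 1) * t `^ (q - 1) * F t s.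
  rewrite /f /g /F /w /pw.
  have -> : t - t * s = t * (1 - s) by ring.
  rewrite !pmulr_rgt0//.
  case: ifPn => s0; last by rewrite !(mul0r,mulr0).
  case: ifPn => s1; last by rewrite !(mul0r,mulr0).
  rewrite !powRM ?(ltW t0) ?(ltW s0) ?(ltW s1)// !mulr1; ring.
under eq_Rintegral do rewrite E.
rewrite RintegralZl// -/(H t) mulrA; congr (_ * _).
rewrite mulrA mulr_powRB1 ?(ltW t0)//.
rewrite -powRD ?(gt_eqF t0) ?implybT//.
by congr (_ `^ _); ring.
Qed.

Lemma causal_conv f g : causal f -> causal g -> causal (conv f g).
Proof.
move=> [p [f1 [p0 cf1 ->]]] [q [g1 [q0 cg1 ->]]].
have [h ch ->] := conv_pw p0 q0 cf1 cg1.
by exists (p + q), h; split => //; exact: addr_gt0.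
Qed.

Lemma convDl f g h : causal f -> causal g -> causal h ->
  conv (fun x => f x + g x) h = (fun t => conv f h t + conv g h t).
Proof.
move=> cf cg ch; apply/funext => t; rewrite /conv.
under eq_Rintegral do rewrite mulrDl.
by rewrite RintegralD//; exact: integrable_convolution.
Qed.

Lemma conv_mulX f g : causal f -> causal g -> forall t,
  t * conv f g t = conv (fun x => x * f x) g t + conv f (fun x => x * g x) t.
Proof.
move=> cf cg t; rewrite /conv.
have cf' := causal_mulX cf; have cg' := causal_mulX cg.
rewrite -RintegralD//; last 2 first.
- exact: (integrable_convolution t cf' cg).
- exact: (integrable_convolution t cf cg').
rewrite -RintegralZl//; last exact: integrable_convolution.
by apply: eq_Rintegral => x _; ring.
Qed.

Lemma convE f g t : causal f -> causal g ->
  ((conv f g t)%:E = \int[mu]_x (f x * g (t - x))%:E)%E.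
Proof.
move=> cf cg; rewrite /conv /Rintegral fineK//.
exact: integrable_fin_num (integrable_convolution t cf cg).
Qed.

(** Fubini for [f x * g (z - x) * h (t - z)]. Its integrability follows from Tonelli because
    absolute values of causal functions are causal, hence [(|f| * |g|) * |h|] is a convergent
    convolution. *)
Lemma convA f g h : causal f -> causal g -> causal h ->
  conv f (conv g h) = conv (conv f g) h.
Proof.
move=> cf cg ch; apply/funext => t.
have cgh := causal_conv cg ch; have cfg := causal_conv cf cg.
apply: EFin_inj; rewrite !convE//.
pose T := measurableTypeR R.
pose Phi (f g h : R -> R) (xz : T * T) : R := f xz.1 * (g (xz.2 - xz.1) * h (t - xz.2)).
have mPhi f' g' h' : causal f' -> causal g' -> causal h' ->
    measurable_fun [set: T * T] (Phi f' g' h').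
  move=> cf' cg' ch'.
  apply: measurable_funM.
    by apply: measurableT_comp; [exact: measurable_causal|exact: measurable_fst].
  apply: measurable_funM.
    apply: measurableT_comp; first exact: measurable_causal.
    by apply: measurable_funB; [exact: measurable_snd|exact: measurable_fst].
  apply: measurableT_comp; first exact: measurable_causal.
  by apply: measurable_funB => //; exact: measurable_snd.
have innerx f' g' h' z : causal f' -> causal g' -> causal h' ->
    (\int[mu]_x (Phi f' g' h' (x, z))%:E = (conv f' g' z * h' (t - z))%:E)%E.
  move=> cf' cg' ch'; rewrite EFinM convE// muleC -integralZl//; last first.
    exact: integrable_convolution.
  by apply: eq_integral => x _; rewrite -EFinM /Phi/=; congr EFin; ring.
have innerz x : (\int[mu]_z (Phi f g h (x, z))%:E = (f x * conv g h (t - x))%:E)%E.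
  rewrite EFinM convE// -integralZl//; last exact: integrable_convolution.
  rewrite -[RHS](integral_shift x); last first.
    apply/measurable_EFinP; apply: measurable_funM => //.
    by apply/measurable_EFinP; apply: measurable_int (integrable_convolution (t - x) cg ch).
  by apply: eq_integral => z _; rewrite -EFinM /Phi/=; congr (f x * (g _ * h _))%:E; ring.
have iPhi : (mu \x mu)%E.-integrable setT (EFin \o Phi f g h).
  apply/integrable21ltyP; first by apply/measurable_EFinP; exact: mPhi.
  have cf' := causal_norm cf; have cg' := causal_norm cg; have ch' := causal_norm ch.
  have cfg' := causal_conv cf' cg'.
  under eq_integral => z _.
    under eq_integral => x _.
      rewrite (_ : `|_|%E = (Phi (fun t => `|f t|) (fun t => `|g t|) (fun t => `|h t|) (x, z))%:E).
        over.
      by rewrite /= /Phi/= !normrM.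
    rewrite innerx//.
    over.
  exact: integrable_lty (integrable_convolution t cfg' ch').
transitivity (\int[mu]_x \int[mu]_z (Phi f g h (x, z))%:E)%E.
  by apply: eq_integral => x _; rewrite innerz.
rewrite (Fubini iPhi).
by apply: eq_integral => z _; rewrite innerx.
Qed.

End Convolution.

(** * Primitives as convolutions with the Heaviside function *)

Section Primitive.
Context {R : realType}.
Local Notation mu := (@lebesgue_measure R).
Implicit Types f g h : R -> R.

Definition heaviside : R -> R := pw 1 (fun=> 1).

Lemma causal_heaviside : causal heaviside.
Proof. by exists 1, (fun=> 1); split => // x; exact: cvg_cst. Qed.

Lemma heaviside_gt0 t : 0 < t -> heaviside t = 1.
Proof. by move=> t0; rewrite /heaviside /pw t0 subrr powRr0 mulr1. Qed.

Lemma conv_heaviside g t : causal g -> conv heaviside g t = \int[mu]_(x in `]0, t[) g x.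
Proof.
move=> cg; rewrite (convC causal_heaviside cg) /conv [RHS]Rintegral_mkcond.
apply: eq_Rintegral => x _; rewrite -cut_causalE// /cut.
have [xt|tx] := ltP x t; first by rewrite heaviside_gt0 ?mulr1// subr_gt0.
by rewrite (causal_le0 causal_heaviside) ?mulr0// subr_le0.
Qed.

Lemma is_derive_itv_integral g (t u : R) : 0 < t -> t < u ->
  mu.-integrable `]0, u[ (EFin \o g) -> {for t, continuous g} ->
  is_derive t (1 : R) (fun y : R => \int[mu]_(x in `]0, y[) g x) (g t).
Proof.
move=> t0 tu ig gt.
pose v := (t + u) / 2.
have tv : t < v by rewrite /v; lra.
have vu : v < u by rewrite /v; lra.
have ig' (s : R) : s < u -> mu.-integrable `]0, s] (EFin \o g).
  move=> su; apply: integrableS ig => // x /=; rewrite !in_itv/= => /andP[-> xs].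
  exact: le_lt_trans su.
have [dF F'] := continuous_FTC1 tv (ig' v vu) (t0 : (BRight 0 < BRight t)%O) gt.
apply: (@near_eq_is_derive R R R (fun y : R => \int[mu]_(x in `]0, y]) g x)).
  near=> y; rewrite Rintegral_itv_bndo_bndc//.
  apply: integrableS (ig' y _) => //.
    by move=> x /=; rewrite !in_itv/= => /andP[-> /ltW].
  by near: y; exact: lt_nbhsl.
rewrite derive1E in F'.
exact: (DeriveDef dF F').
Unshelve. all: by end_near. Qed.

Lemma is_derive_conv_heaviside g (t : R) : causal g -> 0 < t ->
  is_derive t (1 : R) (conv heaviside g) (g t).
Proof.
move=> cg t0.
have -> : conv heaviside g = fun y : R => \int[mu]_(x in `]0, y[) g x.
  by apply/funext => y; exact: conv_heaviside.
have t1 : t < t + 1 by rewrite ltrDl.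
apply: (is_derive_itv_integral t0 t1).
- exact: integrable_causal.
- exact: causal_continuous.
Qed.

(** The difference [f - 1 * g] has zero derivative on the open half line, hence is constant. The
    limit at [0+] is thereby a conclusion, although [g] may be singular there. *)
Lemma primitive_of_causal (f g : R -> R) : causal g ->
  (forall t : R, 0 < t -> is_derive t (1 : R) f (g t)) ->
  exists2 c, (forall t, 0 < t -> f t = c + conv heaviside g t) &
             f t @[t --> 0^'+] --> c.
Proof.
move=> cg df.
pose phi t := f t - conv heaviside g t.
have dphi (t : R) : 0 < t -> is_derive t (1 : R) phi 0.
  move=> t0; have d1 := df t t0; have d2 := is_derive_conv_heaviside cg t0.
  by rewrite -(subrr (g t)); exact: is_deriveB.
have cphi (t : R) : 0 < t -> {for t, continuous phi}.
  by move=> /dphi[dt _]; apply: differentiable_continuous; exact/derivable1_diffP.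
have phic (a b : R) : 0 < a -> a <= b -> phi b = phi a.
  move=> a0 ab.
  have d x : x \in `]a, b[ -> is_derive x (1 : R) phi ((fun=> 0) x).
    by rewrite in_itv/= => /andP[ax _]; apply: dphi; exact: lt_trans ax.
  have c : {within `[a, b], continuous phi}.
    apply: continuous_in_subspaceT => x; rewrite inE/= in_itv/= => /andP[ax _].
    by apply: cphi; exact: lt_le_trans ax.
  have [y _ /eqP] := MVT_segment ab d c.
  by rewrite mul0r subr_eq0 => /eqP.
have E t : 0 < t -> f t = phi 1 + conv heaviside g t.
  move=> t0; have -> : phi 1 = phi t by have [t1|/ltW t1] := leP t 1; [|symmetry]; exact: phic.
  by rewrite /phi subrK.
exists (phi 1) => //.
(* Convolving the exponents [1] and [p] yields [t ^ p] times a continuous function, which tends to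
   [0]. *)
have [p [g1 [p0 cg1 gE]]] := cg.
have [h ch hE] := @conv_pw R 1 p (fun=> 1) g1 ltr01 p0 (fun x => cvg_cst _ (F := nbhs x)) cg1.
suff : f t @[t --> 0^'+] --> phi 1 + 0 * h 0 by rewrite mul0r addr0.
apply: (@cvg_trans _ ((phi 1 + t `^ p * h t) @[t --> 0^'+])).
  apply: near_eq_cvg; near=> t.
  have t0 : 0 < t by near: t; exact: nbhs_right_gt.
  rewrite E// gE hE /pw t0; congr (_ + _ `^ _ * _); ring.
apply: cvgD; first exact: cvg_cst.
apply: cvgM; first exact: powR_cvg0.
by apply: cvg_at_right_filter; exact: ch.
Unshelve. all: by end_near. Qed.

End Primitive.

(** * Functions with bounded exponential moments *)

Section Moments.
Context {R : realType}.
Local Notation mu := (@lebesgue_measure R).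
Implicit Types (f g h phi : R -> R) (D : set R).

Lemma integrable_bounded_mul D f h (B : R) : measurable (D : set (measurableTypeR R)) ->
  measurable_fun [set: R] f -> (forall x, D x -> `|f x| <= B) ->
  mu.-integrable D (EFin \o h) -> mu.-integrable D (EFin \o (fun x => f x * h x)).
Proof.
move=> mD mf fB ih.
have mh := measurable_int _ ih.
apply: (@le_integrable _ _ _ mu _ _ _ (EFin \o (fun x => B * h x))) => //.
- apply/measurable_EFinP; apply: measurable_funM; last exact/measurable_EFinP.
  exact: measurable_funTS.
- move=> x Dx /=; rewrite lee_fin !normrM ler_wpM2r//.
  exact: le_trans (fB x Dx) (ler_norm B).
- exact: integrable_mull.
Qed.

Lemma bernoulli_ge (z : R) n : 0 <= z <= 1 -> 1 - n%:R * z <= (1 - z) ^+ n.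
Proof.
move=> /andP[z0 z1]; elim: n => [|n IH]; first by rewrite mul0r subr0 expr0.
have z1' : 0 <= 1 - z by rewrite subr_ge0.
rewrite exprS; apply: le_trans (ler_wpM2l z1' IH).
rewrite -natr1; have : 0 <= n%:R * (z * z) by rewrite !mulr_ge0.
by nra.
Qed.

(** Combines [1 - z <= exp (- z)] with [n z <= exp (n z)]. Together with Bernoulli's inequality it
    controls the kernel [(1 - z) ^ n] for large and for small [n z]. *)
Lemma expr_onem_le (z : R) n : 0 <= z <= 1 -> (1 - z) ^+ n * (n%:R * z) <= 1.
Proof.
move=> /andP[z0 z1].
have e1 : (1 - z) ^+ n <= expR (- (n%:R * z)).
  rewrite -mulrN expRM_natl lerXn2r// ?nnegrE ?subr_ge0// ?expR_ge0//.
  exact: expR_ge1Dx.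
have e2 : n%:R * z <= expR (n%:R * z).
  by rewrite (le_trans _ (expR_ge1Dx _))// lerDr.
apply: (@le_trans _ _ (expR (- (n%:R * z)) * expR (n%:R * z))).
  by apply: ler_pM => //; rewrite ?exprn_ge0 ?subr_ge0// mulr_ge0.
by rewrite expRN mulVf// gt_eqF// expR_gt0.
Qed.

Lemma cvg_mul_expr (a z : R) : 0 <= z < 1 -> a * z ^+ n @[n --> \oo] --> 0.
Proof.
move=> /andP[z0 z1]; have z1' : `|z| < 1 by rewrite ger0_norm.
by have := cvgM (cvg_cst a) (cvg_expr z1'); rewrite mulr0; exact.
Qed.

(** * Phragmen's approximation of the indicator of []0, t[] *)

Section Phragmen.
Variables (h phi : R -> R) (T M Phi : R).
Hypothesis ih : mu.-integrable `]0, T[ (EFin \o h).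
Hypothesis mphi : measurable_fun [set: R] phi.
Hypothesis phi_gt1 : forall x, 0 < x -> x < T -> 1 < phi x.
Hypothesis phi_le : forall x, 0 < x -> x < T -> phi x <= Phi.
Hypothesis phi_decr : forall x y, 0 < x -> x < y -> y < T -> phi y < phi x.
Hypothesis moments : forall n, `|\int[mu]_(x in `]0, T[) (phi x ^+ n * h x)| <= M.

Let D : set (measurableTypeR R) := `]0, T[%classic.
Let y x := phi x / Phi.

Variable t : R.
Hypotheses (t0 : 0 < t) (tT : t < T).

Let Phi_gt0 : 0 < Phi.
Proof. by rewrite (lt_le_trans ltr01)// (le_trans _ (phi_le t0 tT))// ltW// phi_gt1. Qed.

Let mD : measurable D. Proof. exact: measurable_itv. Qed.

Let y01 x : D x -> 0 <= y x <= 1.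
Proof.
rewrite /D/= in_itv/= => /andP[x0 xT].
rewrite /y ler_pdivrMr// mul1r phi_le// andbT divr_ge0 ?(ltW Phi_gt0)//.
by rewrite (le_trans ler01)// ltW// phi_gt1.
Qed.

Let yn01 n x : D x -> 0 <= y x ^+ n <= 1.
Proof. by move=> /y01/andP[y0 y1]; rewrite exprn_ge0//= exprn_ile1. Qed.

Let my : measurable_fun [set: R] y.
Proof. exact: measurable_funM. Qed.

Let k n j x := (1 - y x ^+ n) ^+ j.

Let mk n j : measurable_fun [set: R] (k n j).
Proof.
apply: measurable_funX; apply: measurable_funB => //.
exact: measurable_funX.
Qed.

Let k01 n j x : D x -> 0 <= k n j x <= 1.
Proof.
move=> /(yn01 n)/andP[a b].
by rewrite exprn_ge0 ?subr_ge0//= exprn_ile1 ?subr_ge0// gerBl.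
Qed.

Let ikh n j m : mu.-integrable D (EFin \o (fun x => k n j x * phi x ^+ m * h x)).
Proof.
apply: (@integrable_bounded_mul D _ h (Phi ^+ m)) => //.
  by apply: measurable_funM => //; exact: measurable_funX.
move=> x Dx; have /andP[a b] := k01 n j Dx.
move: (Dx); rewrite /D/= in_itv/= => /andP[x0 xT].
have p0 : 0 <= phi x by rewrite (le_trans ler01)// ltW// phi_gt1.
have p0m : 0 <= phi x ^+ m by rewrite exprn_ge0.
rewrite ger0_norm ?mulr_ge0// -[leRHS]mul1r; apply: ler_pM => //.
by rewrite lerXn2r ?nnegrE ?(ltW Phi_gt0)// phi_le.
Qed.

Let d n : R := Phi ^- n.
Let d_ge0 n : 0 <= d n. Proof. by rewrite invr_ge0 exprn_ge0// ltW. Qed.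

Let kS n j m : \int[mu]_(x in D) (k n j.+1 x * phi x ^+ m * h x) =
  \int[mu]_(x in D) (k n j x * phi x ^+ m * h x) -
  d n * \int[mu]_(x in D) (k n j x * phi x ^+ (m + n) * h x).
Proof.
rewrite -[X in _ - X]RintegralZl// -RintegralB//; last by apply: integrable_mull => //; exact: ikh.
apply: eq_Rintegral => x _.
by rewrite /k exprS /y /d exprMn exprVn exprD; ring.
Qed.

(** By [kS], each factor [1 - y ^ n] costs at most a factor [1 + d n]. The power [m] is kept general
    because the induction step shifts it by [n]. *)
Let Pbound n j m : `|\int[mu]_(x in D) (k n j x * phi x ^+ m * h x)| <= M * (1 + d n) ^+ j.
Proof.
elim: j m => [|j IH] m.
  rewrite expr0 mulr1; under eq_Rintegral do rewrite /k expr0 mul1r.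
  exact: moments.
rewrite kS (le_trans (ler_normB _ _))// normrM (ger0_norm (d_ge0 n)).
rewrite exprS; have := IH m; have := ler_wpM2l (d_ge0 n) (IH (m + n)%N).
by move=> a b; rewrite (le_trans (lerD b a))// le_eqVlt; apply/orP; left; apply/eqP; ring.
Qed.

(* With [y] scaled to [0, 1] and [N n ~ (Phi / phi t) ^ n], [K n (N n)] converges
   to the indicator of ]0, t[, while as a polynomial in [phi] without constant
   term its coefficients have absolute sum [(1 + d n) ^ N n - 1], which tends
   to [0]. *)
Let K n j x := 1 - k n j x.

Let iK n j : mu.-integrable D (EFin \o (fun x => K n j x * h x)).
Proof.
apply: (@integrable_bounded_mul D _ h 1) => //.
  exact: measurable_funB.
move=> x Dx; have /andP[a b] := k01 n j Dx.
by rewrite ger0_norm /K ?subr_ge0// gerBl.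
Qed.

(** The increment from [K n j] to [K n j.+1] is [d n * phi ^ n * k n j], bounded by [Pbound];
    summing [d n * (1 + d n) ^ i] over [i < j] gives [(1 + d n) ^ j - 1]. *)
Let Kbound n j : `|\int[mu]_(x in D) (K n j x * h x)| <= M * ((1 + d n) ^+ j - 1).
Proof.
elim: j => [|j IH].
  rewrite expr0 subrr mulr0; under eq_Rintegral do rewrite /K /k expr0 subrr mul0r.
  by rewrite /Rintegral integral0/= normr0.
have -> : \int[mu]_(x in D) (K n j.+1 x * h x) =
    \int[mu]_(x in D) (K n j x * h x) + d n * \int[mu]_(x in D) (k n j x * phi x ^+ n * h x).
  rewrite -[X in _ + X]RintegralZl// -RintegralD//; last first.
    by apply: integrable_mull => //; exact: ikh.
  apply: eq_Rintegral => x _.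
  by rewrite /K /k exprS /y /d exprMn exprVn; ring.
rewrite (le_trans (ler_normD _ _))// normrM (ger0_norm (d_ge0 n)).
have := ler_wpM2l (d_ge0 n) (Pbound n j n).
move=> a; rewrite (le_trans (lerD IH a))// le_eqVlt; apply/orP; left; apply/eqP.
by rewrite exprS; ring.
Qed.

Let c := phi t.
Let c_gt1 : 1 < c. Proof. exact: phi_gt1. Qed.
Let c_gt0 : 0 < c. Proof. exact: lt_trans c_gt1. Qed.
Let cPhi : c <= Phi. Proof. exact: phi_le. Qed.
(** With this choice [N n * y x ^ n] has the order of [(phi x / phi t) ^ n], which tends to infinity
    for [x < t] and to [0] for [x > t]. *)
Let N n := (Num.Def.trunc ((Phi / c) ^+ n)).+1.

Let N_bounds n : (Phi / c) ^+ n <= (N n)%:R <= 2 * (Phi / c) ^+ n.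
Proof.
have r1 : 1 <= (Phi / c) ^+ n by rewrite exprn_ege1// ler_pdivlMr// mul1r.
have /andP[a b] := truncn_itv (le_trans ler01 r1).
rewrite (ltW b)/= /N -natr1; lra.
Qed.

Let Kcvg0 : \int[mu]_(x in D) (K n (N n) x * h x) @[n --> \oo] --> 0.
Proof.
have M0 : 0 <= M by exact: le_trans (normr_ge0 _) (moments 0).
(* Since [N n * d n <= 2 / c ^ n], the exponent tends to [0] precisely because [c = phi t > 1]. *)
have E n : (1 + d n) ^+ N n - 1 <= expR (2 * c^-1 ^+ n) - 1.
  rewrite lerD2r (@le_trans _ _ (expR (d n) ^+ N n))//.
    by rewrite lerXn2r ?nnegrE ?expR_ge0 ?addr_ge0// expR_ge1Dx.
  rewrite -expRM_natl ler_expR.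
  have /andP[_ b] := N_bounds n.
  rewrite (le_trans (ler_wpM2r (d_ge0 n) b))// le_eqVlt; apply/orP; left; apply/eqP.
  rewrite /d exprMn exprVn -mulrA; congr (_ * _).
  by rewrite mulrAC divff ?mul1r// expf_neq0// gt_eqF.
have cv : M * (expR (2 * c^-1 ^+ n) - 1) @[n --> \oo] --> 0.
  have cE : expR (2 * c^-1 ^+ n) @[n --> \oo] --> expR 0.
    apply: continuous_cvg; first exact: continuous_expR.
    by apply: cvg_mul_expr; rewrite invr_ge0 (ltW c_gt0) invf_lt1.
  by have := cvgM (cvg_cst M) (cvgB cE (cvg_cst (1 : R))); rewrite expR0 subrr mulr0; exact.
apply/norm_cvg0P; apply: (@squeeze_cvgr _ _ _ _ (cst 0) _ _ _ _ (cvg_cst 0) cv).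
apply: nearW => n; rewrite normr_ge0/= (le_trans (Kbound n (N n)))//.
exact: ler_wpM2l.
Qed.

Let below (x : R) : R := if x < t then 1 else 0.

(** To the left of [t], [expr_onem_le] bounds [1 - K] by [(c / phi x) ^ n]; to the right, Bernoulli
    bounds [K] by [2 (phi x / c) ^ n]. Both ratios are below [1] as [phi] decreases. *)
Let Kpoint x : D x -> x != t -> K n (N n) x @[n --> \oo] --> below x.
Proof.
move=> Dx xt; move: (Dx); rewrite /D/= in_itv/= => /andP[x0 xT].
have px : 0 < phi x by rewrite (lt_trans ltr01)// phi_gt1.
rewrite /below; have [xlt|tx|xE] := ltgtP x t; last by rewrite xE eqxx in xt.
- have cx : c < phi x by exact: phi_decr.
  have E n : 0 <= k n (N n) x <= (c / phi x) ^+ n.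
    have /andP[-> _] /= := k01 n (N n) Dx.
    have := expr_onem_le (N n) (yn01 n Dx); rewrite -/(k n (N n) x) => H.
    have /andP[a _] := N_bounds n.
    rewrite -[(c / phi x) ^+ n]mul1r -ler_pdivrMr ?exprn_gt0 ?divr_gt0//.
    apply: le_trans H; apply: ler_wpM2l; first by have /andP[] := k01 n (N n) Dx.
    have yn0 : 0 <= y x ^+ n by have /andP[] := yn01 n Dx.
    apply: le_trans (ler_wpM2r yn0 a); rewrite -exprMn -exprVn.
    rewrite le_eqVlt; apply/orP; left; apply/eqP; congr (_ ^+ _); rewrite /y; field.
    by rewrite !gt_eqF.
  rewrite /= -[X in _ --> X]subr0; apply: cvgB; first exact: cvg_cst.
  apply: (@squeeze_cvgr _ _ _ _ (cst 0) (fun n => (c / phi x) ^+ n)) => //.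
  + by apply: nearW => n; exact: E.
  + exact: cvg_cst.
  + by apply: cvg_expr; rewrite ger0_norm ?divr_ge0 ?ltW// ltr_pdivrMr// mul1r.
- have xc : phi x < c by exact: phi_decr.
  have E n : 0 <= K n (N n) x <= 2 * (phi x / c) ^+ n.
    have /andP[_ b] := k01 n (N n) Dx; rewrite subr_ge0 b/=.
    have H := bernoulli_ge (N n) (yn01 n Dx).
    have /andP[_ a] := N_bounds n.
    have yn0 : 0 <= y x ^+ n by have /andP[] := yn01 n Dx.
    apply: (@le_trans _ _ ((N n)%:R * y x ^+ n)); first by rewrite /K /k; lra.
    apply: le_trans (ler_wpM2r yn0 a) _; rewrite -mulrA -exprMn.
    rewrite le_eqVlt; apply/orP; left; apply/eqP; congr (_ * _ ^+ _); rewrite /y; field.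
    by rewrite !gt_eqF.
  apply: (@squeeze_cvgr _ _ _ _ (cst 0) (fun n => 2 * (phi x / c) ^+ n)) => //.
  + by apply: nearW => n; exact: E.
  + exact: cvg_cst.
  + by apply: cvg_mul_expr; rewrite divr_ge0 ?ltW//= ltr_pdivrMr// mul1r.
Qed.

Lemma integral_eq0_of_bounded_moments : \int[mu]_(x in `]0, t[) h x = 0.
Proof.
have mh : measurable_fun D h by apply/measurable_EFinP; exact: measurable_int ih.
have mlt : measurable_fun D below.
  apply: measurable_funTS.
  by apply: measurable_fun_ifT => //; exact: measurable_fun_ltr.
have [|||||_ _ cv] := @dominated_convergence _ _ R mu D mD
  (fun n x => (K n (N n) x * h x)%:E) (fun x => (below x * h x)%:E)
  (fun x => `|h x|%:E).
- by move=> n; exact: measurable_int (iK n (N n)).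
- by apply/measurable_EFinP; exact: measurable_funM.
(* Nothing is claimed about the limit at [x = t], a negligible point. *)
- exists [set t]; split => //; first exact: lebesgue_measure_set1.
  move=> x /=; apply: contra_notP => /eqP xt Dx.
  apply: cvg_EFin; first exact: nearW.
  by apply: cvgM; [exact: Kpoint|exact: cvg_cst].
- exact: integrable_norm ih.
- apply: aeW => x n Dx; rewrite /= lee_fin normrM.
  have /andP[a b] := k01 n (N n) Dx.
  by rewrite -[leRHS]mul1r ler_wpM2r// ger0_norm /K ?subr_ge0// gerBl.
have : (\int[mu]_(x in D) (K n (N n) x * h x)%:E)%E @[n --> \oo] --> 0%:E.
  apply: cvg_EFin; last exact: Kcvg0.
  by apply: nearW => n; exact: integrable_fin_num (iK n (N n)).
move=> /(cvg_unique (@ereal_hausdorff R) cv)/= I0.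
rewrite Rintegral_mkcond /Rintegral.
suff -> : (\int[mu]_x (h \_ `]0, t[ x)%:E = \int[mu]_(x in D) (below x * h x)%:E)%E.
  by rewrite I0.
rewrite [RHS]integral_mkcond; apply: eq_integral => x _.
have itvE z : (x \in (`]0, z[%classic : set R)) = (0 < x < z).
  by apply/idP/idP; rewrite inE/= in_itv.
rewrite !patchE /D !itvE /below; have [x0|x0] := ltP 0 x => //=.
have [xt|xt] := ltP x t; first by rewrite (lt_trans xt tT) mul1r.
by rewrite mul0r if_same.
Qed.

End Phragmen.

(** The integrals of [h] over []0, s[] vanish for all [s] near [t], and by continuity of [h] their
    derivative at [t] is [h t]. *)
Lemma eq0_of_bounded_moments h phi (T M Phi : R) :
  mu.-integrable `]0, T[ (EFin \o h) ->
  (forall x, 0 < x -> x < T -> {for x, continuous h}) ->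
  measurable_fun [set: R] phi ->
  (forall x, 0 < x -> x < T -> 1 < phi x <= Phi) ->
  (forall x y, 0 < x -> x < y -> y < T -> phi y < phi x) ->
  (forall n, `|\int[mu]_(x in `]0, T[) (phi x ^+ n * h x)| <= M) ->
  forall t, 0 < t -> t < T -> h t = 0.
Proof.
move=> ih ch mphi phib phid mom t t0 tT.
have [_ <-] := is_derive_itv_integral t0 tT ih (ch t t0 tT).
rewrite (near_eq_derive (g := fun=> 0)) ?derive_cst//.
near=> s; apply: (@integral_eq0_of_bounded_moments h phi T M Phi) => //.
- by move=> x x0 xT; have /andP[] := phib x x0 xT.
- by move=> x x0 xT; have /andP[] := phib x x0 xT.
- by near: s; exact: lt_nbhsr.
- by near: s; exact: lt_nbhsl.
Unshelve. all: by end_near. Qed.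

End Moments.

(** * Square-zero elements *)

Section SquareZero.
Context {R : realType}.
Local Notation mu := (@lebesgue_measure R).
Implicit Types (a b f g h : R -> R).

(** For merely integrable factors the convolution integral is finite only almost everywhere;
    elsewhere [conv] takes the default value of [fine]. It thus agrees almost everywhere with the
    Fubini section integral, which is enough for the integrals. *)
Lemma integrable_Rintegral_conv a b :
  mu.-integrable [set: R] (EFin \o a) -> mu.-integrable [set: R] (EFin \o b) ->
  mu.-integrable [set: R] (EFin \o conv a b) /\
  \int[mu]_z conv a b z = \int[mu]_x a x * \int[mu]_x b x.
Proof.
move=> ia ib.
have ma := measurable_int _ ia; have mb := measurable_int _ ib.
pose T := measurableTypeR R.
pose Psi (zx : T * T) : R := a zx.2 * b (zx.1 - zx.2).
have mPsi : measurable_fun [set: T * T] Psi.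
  apply: measurable_funM.
    by apply: measurableT_comp; [exact/measurable_EFinP|exact: measurable_snd].
  apply: measurableT_comp; first exact/measurable_EFinP.
  by apply: measurable_funB; [exact: measurable_fst|exact: measurable_snd].
have ina := integrable_norm ia; have inb := integrable_norm ib.
have fine_int k : mu.-integrable [set: R] (EFin \o k) ->
    (\int[mu]_x (k x)%:E = (\int[mu]_x k x)%:E)%E.
  by move=> ik; rewrite /Rintegral fineK//; exact: integrable_fin_num ik.
have iPsi : (mu \x mu)%E.-integrable setT (EFin \o Psi).
  apply/integrable21ltyP; first exact/measurable_EFinP.
  rewrite (_ : (\int[mu]_x _)%E = (\int[mu]_x (`|a x| * \int[mu]_x `|b x|)%:E)%E).
    by apply: integrable_lty => //; under eq_fun do rewrite mulrC; exact: integrable_mull.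
  apply: eq_integral => x _ /=.
  rewrite EFinM -(fine_int _ inb) -integralZl//.
  rewrite -[RHS](integral_shift x); last first.
    apply/measurable_EFinP; apply: measurable_funM => //.
    by apply/measurable_EFinP; exact: measurable_int inb.
  by apply: eq_integral => z _; rewrite /Psi/= normrM.
have iF := integrable_fubini_F iPsi.
have cE : conv a b = fine \o fubini_F mu (EFin \o Psi) by [].
have ic : mu.-integrable [set: R] (EFin \o conv a b).
  apply: (le_integrable _ _ _ iF) => //.
    apply/measurable_EFinP; rewrite cE; apply: measurableT_comp => //.
    exact: measurable_int iF.
  move=> z _; rewrite cE /=; set u := fubini_F _ _ _.
  by case: u => [r| |]//=; rewrite ?normr0 leey.
split => //.
apply: EFin_inj; rewrite -fine_int// EFinM -fine_int// -integralZr//.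
transitivity (\int[mu]_z fubini_F mu (EFin \o Psi) z)%E.
  apply: ae_eq_integral => //.
  - exact: measurable_int ic.
  - exact: measurable_int iF.
  - have := integrable_ae measurableT iF; apply: filterS => z /(_ I) /= Fz _.
    by rewrite cE/= fineK.
rewrite /fubini_F (Fubini iPsi); apply: eq_integral => x _ /=.
transitivity ((a x)%:E * \int[mu]_z (b (z - x))%:E)%E.
  by rewrite -integralZl//; exact: integrable_shift.
rewrite (@integral_shift R x (EFin \o b))//; congr (_ * _)%E; exact: fine_int.
Qed.

Definition laplace (L : R) (n : nat) f : R :=
  \int[mu]_(x in `]0, L[) (expR (- (n%:R * x)) * f x).

Definition norm1 (L : R) f : R := \int[mu]_x `|cut L f x|.

Lemma measurable_expRN n : measurable_fun [set: R] (fun x : R => expR (- (n%:R * x))).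
Proof.
apply: measurableT_comp => //; exact: measurableT_comp.
Qed.

Lemma expRN_le1 n (x : R) : 0 <= x -> expR (- (n%:R * x)) <= 1.
Proof. by move=> x0; rewrite -expR0 ler_expR oppr_le0 mulr_ge0. Qed.

Lemma integrable_expRN_causal L n f : causal f ->
  mu.-integrable `]0, L[ (EFin \o (fun x => expR (- (n%:R * x)) * f x)).
Proof.
move=> cf; apply: (@integrable_bounded_mul R _ _ f 1) => //.
- exact: measurable_expRN.
- move=> x /=; rewrite in_itv/= => /andP[x0 _].
  by rewrite ger0_norm ?expR_ge0// expRN_le1// ltW.
- exact: integrable_causal.
Qed.

(* The product of the truncated transforms is the integral of
   [exp (- n (x + y)) f x g y] over a square; the part [x + y < L] gives
   the transform of the convolution, and on the rest [exp (- n (x + y))] is at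
   most [exp (- n L)]. *)
Lemma laplace_conv L n f g : causal f -> causal g ->
  `|laplace L n f * laplace L n g - laplace L n (conv f g)| <=
  expR (- (n%:R * L)) * (norm1 L f * norm1 L g).
Proof.
move=> cf cg.
pose e x : R := expR (- (n%:R * x)).
pose E h x : R := e x * cut L h x.
have cfg := causal_conv cf cg.
have EE h : causal h -> E h = (fun x => e x * h x) \_ `]0, L[.
  move=> ch; apply/funext => x; rewrite /E cut_causalE// !patchE.
  by case: ifP => // _; rewrite mulr0.
have iE h : causal h -> mu.-integrable [set: R] (EFin \o E h).
  move=> ch; rewrite EE// -restrict_EFin; apply: (integrable_mkcond _ _).1 => //.
  exact: integrable_expRN_causal.
have lE h : causal h -> laplace L n h = \int[mu]_x E h x.
  by move=> ch; rewrite /laplace Rintegral_mkcond EE.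
rewrite !lE//.
have [iEE <-] := integrable_Rintegral_conv (iE f cf) (iE g cg).
have [iN <-] := integrable_Rintegral_conv (integrable_norm (integrable_cut L cf))
  (integrable_norm (integrable_cut L cg)).
have iEc := iE _ cfg.
rewrite -RintegralB// -RintegralZl//.
have iD : mu.-integrable [set: R] (EFin \o (fun z => conv (E f) (E g) z - E (conv f g) z)).
  exact: (@integrableB _ _ _ mu _ _ (EFin \o conv (E f) (E g)) (EFin \o E (conv f g))).
apply: le_trans (le_normr_Rintegral _ _) _ => //.
apply: le_Rintegral => //; first exact: integrable_norm iD.
  exact: integrable_mull.
move=> z _ /=.
have -> : E (conv f g) z = e z * (if z < L then conv f g z else 0) by [].
have eM x : e x * e (z - x) = e z by rewrite /e -expRD; congr expR; ring.
have cut_abs h x : `|cut L h x| <= `|h x| by rewrite /cut; case: ifP; rewrite ?normr0.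
have [zL|Lz] := ltP z L.
  suff -> : conv (E f) (E g) z = e z * conv f g z.
    rewrite subrr normr0; apply: mulr_ge0; first exact: expR_ge0.
    by apply: Rintegral_ge0 => x _; rewrite /= mulr_ge0.
  rewrite /conv -RintegralZl//; last exact: integrable_convolution.
  apply: eq_Rintegral => x _; rewrite /E -(eM x) /cut.
  have [x0|x0] := leP x 0; first by rewrite (causal_le0 cf x0) if_same !(mulr0,mul0r).
  have [zx|xz] := leP z x.
    by rewrite (causal_le0 cg) ?if_same ?(mulr0,mul0r) ?subr_le0.
  have -> : x < L by exact: lt_trans zL.
  have -> : z - x < L by lra.
  by ring.
rewrite mulr0 subr0.
have iN' : mu.-integrable [set: R] (EFin \o (fun x => `|cut L f x| * `|cut L g (z - x)|)).
  apply: le_integrable (integrable_convolution z cf cg) => //.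
    apply/measurable_EFinP; apply: measurable_funM.
      by apply/measurable_EFinP; exact: measurable_int (integrable_norm (integrable_cut L cf)).
    apply/measurable_EFinP.
    exact: measurable_int (integrable_subl z (integrable_norm (integrable_cut L cg))).
  by move=> x _ /=; rewrite lee_fin !normrM !normr_id ler_pM.
have iEz : mu.-integrable [set: R] (EFin \o (fun x => E f x * E g (z - x))).
  apply: (le_integrable _ _ _ (integrable_mull (e z) _ iN')) => //.
    apply/measurable_EFinP; apply: measurable_funM.
      by apply/measurable_EFinP; exact: measurable_int (iE f cf).
    by apply/measurable_EFinP; exact: measurable_int (integrable_subl z (iE g cg)).
  move=> x _ /=; rewrite lee_fin /E mulrACA eM !normrM !normr_id.
  by rewrite mulrA.
rewrite /conv.
apply: le_trans (le_normr_Rintegral _ _) _ => //.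
rewrite -RintegralZl//; apply: le_Rintegral => //; first exact: integrable_norm iEz.
  exact: integrable_mull.
move=> x _ /=; rewrite /E mulrACA eM !normrM ler_wpM2r ?mulr_ge0//.
by rewrite ger0_norm ?expR_ge0// /e ler_expR lerN2 ler_wpM2l.
Qed.

Lemma norm1_ge0 L f : 0 <= norm1 L f.
Proof. exact: Rintegral_ge0. Qed.

(** Only [[T, 2T[] contributes to the difference, and there the exponential is at most
    [exp (- nT)]. *)
Lemma laplace_tail (T : R) n f : causal f -> 0 < T ->
  `|laplace T n f - laplace (T + T) n f| <= expR (- (n%:R * T)) * norm1 (T + T) f.
Proof.
move=> cf T0.
pose e x : R := expR (- (n%:R * x)).
have lE L : laplace L n f = \int[mu]_x (e x * cut L f x).
  rewrite /laplace Rintegral_mkcond; apply: eq_Rintegral => x _.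
  by rewrite cut_causalE// !patchE; case: ifP => // _; rewrite mulr0.
have iE L : mu.-integrable [set: R] (EFin \o (fun x => e x * cut L f x)).
  have -> : (fun x => e x * cut L f x) = (fun x => e x * f x) \_ `]0, L[.
    apply/funext => x; rewrite cut_causalE// !patchE.
    by case: ifP => // _; rewrite mulr0.
  rewrite -restrict_EFin; apply: (integrable_mkcond _ _).1 => //.
  exact: integrable_expRN_causal.
rewrite !lE -RintegralB// /norm1.
have iN := integrable_norm (integrable_cut (T + T) cf).
rewrite -RintegralZl//.
have iD : mu.-integrable [set: R] (EFin \o (fun x => e x * cut T f x - e x * cut (T + T) f x)).
  exact: (@integrableB _ _ _ mu _ _ (EFin \o (fun x => e x * cut T f x))
    (EFin \o (fun x => e x * cut (T + T) f x))).
apply: le_trans (le_normr_Rintegral _ _) _ => //.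
apply: le_Rintegral => //; first exact: integrable_norm iD.
  exact: integrable_mull.
move=> x _ /=; rewrite -mulrBr /cut.
have [xT|Tx] := ltP x T.
  have -> : x < T + T by lra.
  by rewrite subrr mulr0 normr0 mulr_ge0// expR_ge0.
rewrite sub0r normrM normrN ler_wpM2r// ger0_norm ?expR_ge0//.
by rewrite /e ler_expR lerN2 ler_wpM2l.
Qed.

(* The pair [(f, g)] stands for the complex function [f + i g]. *)
Lemma laplace_square_zero_bound (T : R) n f g : causal f -> causal g -> 0 < T ->
  conv f f = conv g g -> conv f g = (fun=> 0) ->
  `|laplace (T + T) n f| <= expR (- (n%:R * T)) * (norm1 (T + T) f + norm1 (T + T) g).
Proof.
move=> cf cg T0 ffgg fg0; set L := T + T.
set A := laplace L n f; set B := laplace L n g.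
set a := norm1 L f; set b := norm1 L g; set e := expR (- (n%:R * T)).
have a0 : 0 <= a by exact: norm1_ge0. have b0 : 0 <= b by exact: norm1_ge0.
have e0 : 0 <= e by exact: expR_ge0.
have eL : expR (- (n%:R * L)) = e * e by rewrite /e -expRD /L; congr expR; ring.
have := laplace_conv L n cf cf; have := laplace_conv L n cg cg.
have := laplace_conv L n cf cg; rewrite ffgg fg0 eL -/A -/B -/a -/b.
have -> : laplace L n (fun=> 0) = 0.
  rewrite /laplace; under eq_Rintegral do rewrite mulr0.
  by rewrite /Rintegral integral0.
rewrite subr0; set c := laplace L n _.
rewrite !ler_norml => /andP[h1 h2] /andP[h3 h4] /andP[h5 h6].
(* This is the fourth power of the modulus of [A + i B]. As [f * f = g * g], the transforms of the
   squares cancel in [A^2 - B^2], and as [f * g = 0] only the error is left in [A B]. Two square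
   roots then give the bound for [A]. *)
have H : (A ^+ 2 + B ^+ 2) ^+ 2 <= ((e * (a + b)) ^+ 2) ^+ 2.
  have D1 : (A ^+ 2 - B ^+ 2) ^+ 2 <= (e * e * (a * a + b * b)) ^+ 2.
    rewrite -[leLHS]real_normK ?num_real// lerXn2r// ?nnegrE ?mulr_ge0 ?addr_ge0 ?mulr_ge0//.
    rewrite ler_norml; apply/andP; split; rewrite !expr2; lra.
  have D2 : (A * B) ^+ 2 <= (e * e * (a * b)) ^+ 2.
    rewrite -[leLHS]real_normK ?num_real// lerXn2r// ?nnegrE ?mulr_ge0//.
    by rewrite ler_norml h1.
  have -> : (A ^+ 2 + B ^+ 2) ^+ 2 = (A ^+ 2 - B ^+ 2) ^+ 2 + 4 * (A * B) ^+ 2 by ring.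
  apply: (@le_trans _ _ ((e * e * (a * a + b * b)) ^+ 2 + 4 * (e * e * (a * b)) ^+ 2)).
    by rewrite lerD// ler_wpM2l.
  rewrite -subr_ge0.
  have -> : ((e * (a + b)) ^+ 2) ^+ 2 - ((e * e * (a * a + b * b)) ^+ 2 +
    4 * (e * e * (a * b)) ^+ 2) = e ^+ 4 * (4 * (a * a * a * b) + 4 * (a * b * b * b)) by ring.
  by rewrite mulr_ge0 ?exprn_ge0// addr_ge0// !mulr_ge0.
have s0 : 0 <= A ^+ 2 + B ^+ 2 by rewrite addr_ge0// sqr_ge0.
have r0 : 0 <= e * (a + b) by rewrite mulr_ge0// addr_ge0.
move: H; rewrite ler_sqr ?nnegrE ?sqr_ge0// => H.
rewrite -ler_norml -ler_sqr ?nnegrE// real_normK ?num_real//.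
by apply: le_trans H; rewrite lerDl sqr_ge0.
Qed.

Lemma square_zero_left f g : causal f -> causal g ->
  conv f f = conv g g -> conv f g = (fun=> 0) -> f = (fun=> 0).
Proof.
move=> cf cg ffgg fg0; apply/funext => t.
have [t0|t0] := leP t 0; first exact: causal_le0 cf t0.
pose T := t + 1; have T0 : 0 < T by rewrite /T; lra.
pose M := norm1 (T + T) f + (norm1 (T + T) f + norm1 (T + T) g).
apply: (@eq0_of_bounded_moments R f (fun x => expR (T - x)) T M (expR T)) => //.
- exact: integrable_causal.
- by move=> x x0 _; exact: causal_continuous.
- by apply: measurableT_comp => //; exact: measurable_subl.
- by move=> x x0 xT; rewrite expR_gt1 subr_gt0 xT ler_expR gerBl ltW.
- by move=> x y _ xy _; rewrite ltr_expR ltrD2l ltrN2.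
- move=> n.
  have -> : \int[mu]_(x in `]0, T[) (expR (T - x) ^+ n * f x) =
      expR (n%:R * T) * laplace T n f.
    rewrite /laplace -RintegralZl//; last exact: integrable_expRN_causal.
    apply: eq_Rintegral => x _; rewrite mulrA -expRD -expRM_natl; congr (expR _ * _); ring.
  rewrite normrM ger0_norm ?expR_ge0//.
  (* The transform over []0, T[] differs from the one over []0, 2T[] by the tail; both the tail and
     the latter are of order [exp (- nT)], which the factor [exp (nT)] cancels. *)
  have H : `|laplace T n f| <= expR (- (n%:R * T)) * M.
    rewrite -[laplace T n f](subrK (laplace (T + T) n f)).
    rewrite (le_trans (ler_normD _ _))// /M mulrDr lerD//; first exact: laplace_tail.
    exact: laplace_square_zero_bound.
  apply: le_trans (ler_wpM2l (expR_ge0 _) H) _.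
  by rewrite mulrA -expRD subrr expR0 mul1r.
- by rewrite /T; lra.
Qed.

End SquareZero.

(** * The convolution ring *)

Section CausalZmodule.
Context {R : realType}.

Definition causal_pred : {pred R -> R} := fun f => `[< causal f >].

Lemma causal_predP (f : R -> R) : reflect (causal f) (f \in causal_pred).
Proof. exact: asboolP. Qed.

Lemma causal0 : causal (fun=> 0 : R).
Proof.
exists 1, (fun=> 0); split => //; first by move=> x; exact: cvg_cst.
by apply/funext => t; rewrite /pw mulr0 if_same.
Qed.

Lemma causal_zmod_closed : zmod_closed causal_pred.
Proof.
split=> [|f g /causal_predP cf /causal_predP cg]; apply/causal_predP.
  exact: causal0.
exact: causalD cf (causal_opp cg).
Qed.

HB.instance Definition _ :=
  GRing.isZmodClosed.Build (R -> R) causal_pred causal_zmod_closed.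

Record causal_fun := CausalFun { cfun :> R -> R; _ : cfun \in causal_pred }.

HB.instance Definition _ := [isSub for cfun].
HB.instance Definition _ := [Choice of causal_fun by <:].
HB.instance Definition _ := [SubChoice_isSubZmodule of causal_fun by <:].

Implicit Types f g h : causal_fun.

Lemma cfunP f : causal f.
Proof. by apply/causal_predP; case: f. Qed.

Lemma cfunD f g : cfun (f + g) = (fun t => f t + g t).
Proof. exact: (raddfD val). Qed.

Lemma cfunN f : cfun (- f) = (fun t => - f t).
Proof. exact: (raddfN val). Qed.

Definition cmul f g : causal_fun :=
  CausalFun (introT (causal_predP _) (causal_conv (cfunP f) (cfunP g))).

Lemma cmulC f g : cmul f g = cmul g f.
Proof. by apply: val_inj; apply: convC; exact: cfunP. Qed.

Lemma cmulA f g h : cmul f (cmul g h) = cmul (cmul f g) h.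
Proof. by apply: val_inj; apply: convA; exact: cfunP. Qed.

Lemma cmulDl f g h : cmul (f + g) h = cmul f h + cmul g h.
Proof.
apply: val_inj; change (conv (cfun (f + g)) h = cfun (cmul f h + cmul g h)).
by rewrite !cfunD convDl//; exact: cfunP.
Qed.

Lemma cmulDr f g h : cmul h (f + g) = cmul h f + cmul h g.
Proof. by rewrite ![cmul h _]cmulC cmulDl. Qed.

Lemma cmul0l f : cmul 0 f = 0.
Proof. by apply: (addIr (cmul 0 f)); rewrite -cmulDl !add0r. Qed.

Lemma cmulNl f g : cmul (- f) g = - cmul f g.
Proof. by apply: (addIr (cmul f g)); rewrite -cmulDl !addNr cmul0l. Qed.

Lemma cmulMzl f g (n : int) : cmul (f *~ n) g = cmul f g *~ n.
Proof.
have nat_case (m : nat) : cmul (f *+ m) g = cmul f g *+ m.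
  by elim: m => [|m IH]; rewrite ?mulr0n ?cmul0l// !mulrS cmulDl IH.
by case: n => m; rewrite ?NegzE ?mulrNz ?cmulNl -!pmulrn nat_case.
Qed.

Lemma cmulMzr f g (n : int) : cmul f (g *~ n) = cmul f g *~ n.
Proof. by rewrite cmulC cmulMzl cmulC. Qed.

End CausalZmodule.
Arguments causal_fun : clear implicits.

(* Convolution of functions has no unit; adjoining a copy of [int] turns the
   causal functions into an ideal of a genuine commutative ring. *)
Section Unitization.
Context {R : realType}.

Definition causal_ring : Type := (int * causal_fun R)%type.

HB.instance Definition _ := GRing.Zmodule.on causal_ring.

Implicit Types x y z : causal_ring.

Definition cr_one : causal_ring := (1, 0).
(** The product of formal sums [m + f] and [n + g], integers acting by repeated addition. *)
Definition cr_mul x y : causal_ring :=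
  (x.1 * y.1, y.2 *~ x.1 + x.2 *~ y.1 + cmul x.2 y.2).

Lemma cr_mulC : commutative cr_mul.
Proof.
move=> [m f] [n g]; rewrite /cr_mul/= mulrC cmulC; congr (_, _ + _).
exact: addrC.
Qed.

Lemma cr_mulA : associative cr_mul.
Proof.
move=> [m f] [n g] [p h]; rewrite /cr_mul/= mulrA; congr (_, _).
rewrite !(mulrzDl, cmulDl, cmulDr, cmulMzl, cmulMzr) -!mulrzA cmulA.
rewrite (mulrC n m) (mulrC p m) !addrA.
by rewrite [LHS](ACl (1*2*4*6*3*5*7)%AC).
Qed.

Lemma cr_mul1 : left_id cr_one cr_mul.
Proof. by move=> [m f]; rewrite /cr_mul/= mul1r mul0rz cmul0l !addr0. Qed.

Lemma cr_mulDl : left_distributive cr_mul +%R.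
Proof.
move=> [m f] [n g] [p h]; rewrite /cr_mul/=; congr (_, _); first exact: mulrDl.
rewrite mulrzDr mulrzDl cmulDl !addrA.
by rewrite [LHS](ACl (1*3*5*2*4*6)%AC).
Qed.

Lemma cr_one_neq0 : cr_one != 0.
Proof. by []. Qed.

HB.instance Definition _ := GRing.Zmodule_isComNzRing.Build causal_ring
  cr_mulA cr_mulC cr_mul1 cr_mulDl cr_one_neq0.

End Unitization.
Arguments causal_ring : clear implicits.

(** * Adjoining a square root of -1 to a commutative ring *)

Section Complexification.
Context {A : comNzRingType}.

Definition cplx : Type := (A * A)%type.

HB.instance Definition _ := GRing.Zmodule.on cplx.

Implicit Types x y z : cplx.

Definition cx_one : cplx := (1, 0).
Definition cx_mul x y : cplx :=
  (x.1 * y.1 - x.2 * y.2, x.1 * y.2 + x.2 * y.1).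

Lemma cx_mulC : commutative cx_mul.
Proof. by move=> [a b] [c d]; rewrite /cx_mul/=; congr (_, _); ring. Qed.

Lemma cx_mulA : associative cx_mul.
Proof. by move=> [a b] [c d] [e f]; rewrite /cx_mul/=; congr (_, _); ring. Qed.

Lemma cx_mul1 : left_id cx_one cx_mul.
Proof. by move=> [a b]; rewrite /cx_mul/=; congr (_, _); ring. Qed.

Lemma cx_mulDl : left_distributive cx_mul +%R.
Proof. by move=> [a b] [c d] [e f]; rewrite /cx_mul/=; congr (_, _); rewrite /=; ring. Qed.

Lemma cx_one_neq0 : cx_one != 0.
Proof. by apply/eqP => -[/eqP]; rewrite oner_eq0. Qed.

HB.instance Definition _ := GRing.Zmodule_isComNzRing.Build cplx
  cx_mulA cx_mulC cx_mul1 cx_mulDl cx_one_neq0.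

End Complexification.
Arguments cplx : clear implicits.

(** * The theorem of Titchmarsh *)

Section Titchmarsh.
Context {R : realType}.
Local Notation mu := (@lebesgue_measure R).
Local Notation C := (cplx (causal_ring R)).
Local Notation V := (causal_fun R * causal_fun R)%type.
Implicit Types (f g : causal_fun R) (x y u v : V).

(* The complex function [u.1 + i u.2] in the complexified ring. *)
Definition inj_cplx u : C := ((0, u.1), (0, u.2)).
Local Notation J := inj_cplx.

Lemma cfun_eq0 f : (forall t, 0 < t -> f t = 0) -> f = 0.
Proof.
move=> f0; apply: val_inj; apply/funext => t; change (cfun f t = 0).
by have [t0|t0] := leP t 0; [exact: causal_le0 (cfunP f) t0|exact: f0].
Qed.

Definition vmul u v : V :=
  (cmul u.1 v.1 - cmul u.2 v.2, cmul u.1 v.2 + cmul u.2 v.1).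

Lemma J_inj : injective J.
Proof. by move=> [a b] [c d] [-> ->]. Qed.

Lemma J0 : J 0 = 0. Proof. by []. Qed.

Lemma JD u v : J (u + v) = J u + J v.
Proof. by congr (_, _); congr (_, _); rewrite addr0. Qed.

Lemma JN u : J (- u) = - J u.
Proof. by congr (_, _); congr (_, _); rewrite oppr0. Qed.

Lemma JM u v : J (vmul u v) = J u * J v.
Proof.
have E f g : ((0, f) : causal_ring R) * (0, g) = (0, cmul f g).
  by congr (_, _); rewrite /= ?mulr0// !mulr0z !add0r.
rewrite /J /vmul /GRing.mul/= /cx_mul/= !E.
by congr (_, _); congr (_, _); rewrite ?oppr0 ?addr0.
Qed.

(** The real and imaginary parts of the equation are [f * f = g * g] and [2 (f * g) = 0]; these are
    symmetric in [f] and [g], so the real lemma applies to each. *)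
Lemma J_square_eq0 u : J u * J u = 0 -> u = 0.
Proof.
rewrite -JM -J0 => /J_inj; case: u => f g [/eqP]; rewrite subr_eq0 => /eqP fg.
move=> gf.
have gf0 : conv f g = (fun=> 0).
  apply/funext => t.
  have : conv f g t + conv g f t = 0 by exact: (congr1 (@^~ t) gf).
  by rewrite (convC (cfunP g) (cfunP f)) -mulr2n => /eqP; rewrite mulrn_eq0 => /eqP.
have f0 := square_zero_left (cfunP f) (cfunP g) fg gf0.
have g0 : (g : R -> R) = (fun=> 0).
  apply: (square_zero_left (cfunP g) (cfunP f) (esym fg)).
  by rewrite convC//; exact: cfunP.
by congr (_, _); apply: cfun_eq0 => t _; rewrite ?f0 ?g0.
Qed.

Definition mulX f : causal_fun R :=
  CausalFun (introT (causal_predP _) (causal_mulX (cfunP f))).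

Lemma mulXM f g : mulX (cmul f g) = cmul (mulX f) g + cmul f (mulX g).
Proof.
apply: val_inj; change (cfun (mulX (cmul f g)) = cfun (cmul (mulX f) g + cmul f (mulX g))).
rewrite cfunD; apply/funext => t; apply: conv_mulX; exact: cfunP.
Qed.

Lemma mulXD f g : mulX (f + g) = mulX f + mulX g.
Proof.
apply: val_inj; change (cfun (mulX (f + g)) = cfun (mulX f + mulX g)).
by rewrite cfunD; apply/funext => t; exact: mulrDr.
Qed.

Lemma mulXN f : mulX (- f) = - mulX f.
Proof.
apply: val_inj; change (cfun (mulX (- f)) = cfun (- mulX f)).
by rewrite cfunN; apply/funext => t; exact: mulrN.
Qed.

Definition vX u : V := (mulX u.1, mulX u.2).

Lemma vXM u v : vX (vmul u v) = vmul (vX u) v + vmul u (vX v).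
Proof.
rewrite /vX /vmul/= mulXD mulXN mulXD !mulXM; congr (_, _).
  by rewrite /= opprD addrACA.
by rewrite /= addrACA.
Qed.

(* Multiplication by [t] is a derivation of the convolution ring, so the square
   of [u * tv] vanishes along with [u * v]. *)
Lemma J_mul_vX u v : J u * J v = 0 -> J u * J (vX v) = 0.
Proof.
move=> uv0.
have d : J (vX u) * J v + J u * J (vX v) = 0.
  have uv : vmul u v = 0 by apply: J_inj; rewrite JM uv0.
  rewrite -!JM -JD -vXM uv -J0; congr J.
  congr (_, _); apply: val_inj; apply/funext => t; exact: mulr0.
rewrite -JM; apply/eqP; rewrite -J0; apply/eqP; congr J; apply: J_square_eq0.
(* Replacing one factor [u * tv] by [- (tu * v)] and regrouping exhibits the factor [u * v = 0] in
   the square. *)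
rewrite JM.
have e : J u * J (vX v) = - (J (vX u) * J v) by apply/eqP; rewrite -addr_eq0 addrC d.
rewrite {1}e.
have -> : - (J (vX u) * J v) * (J u * J (vX v)) = - (J u * J v) * (J (vX u) * J (vX v)) by ring.
by rewrite uv0 oppr0 mul0r.
Qed.

(** The factor [1 + t] becomes [1 + (T - s)] inside a convolution at [T]; it exceeds [1] on []0,
    T[], as the moment argument demands. *)
Definition mul1X f : causal_fun R := f + mulX f.

Lemma iter_mul1XE n f t : cfun (iter n mul1X f) t = (1 + t) ^+ n * f t.
Proof.
elim: n => [|n IH]; first by rewrite expr0 mul1r.
by rewrite iterS {1}/mul1X cfunD /= IH exprS; ring.
Qed.

Lemma J_mul_iter n u v : J u * J v = 0 ->
  J u * J (iter n mul1X v.1, iter n mul1X v.2) = 0.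
Proof.
move=> uv0; elim: n => [|n IH]; first by rewrite -surjective_pairing.
rewrite !iterS /mul1X.
rewrite (_ : (_, _) = (iter n mul1X v.1, iter n mul1X v.2) +
  vX (iter n mul1X v.1, iter n mul1X v.2))//.
by rewrite JD mulrDr IH add0r; exact: J_mul_vX.
Qed.

(** Two products are allowed so that the real and the imaginary part of a complex convolution are
    both covered. The hypothesis, evaluated at [T], says that all moments of [h] against
    [(1 + (T - s)) ^ n] are zero. *)
Lemma pointwise_eq0_of_moments f1 g1 f2 g2 :
  (forall n, cmul f1 (iter n mul1X g1) + cmul f2 (iter n mul1X g2) = 0) ->
  forall a b, 0 < a -> 0 < b -> f1 a * g1 b + f2 a * g2 b = 0.
Proof.
move=> H a b a0 b0.
(* Then [T - a = b], and the desired expression is [h a]. *)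
pose T := a + b; have T0 : 0 < T by exact: addr_gt0.
pose h s := f1 s * g1 (T - s) + f2 s * g2 (T - s).
suff : h a = 0 by rewrite /h /T [a + b]addrC addrK.
have cT g (s : R) : s < T -> {for s, continuous (fun s => g (T - s))}.
  move=> sT; apply: (@continuous_comp R R R (fun s => T - s) g).
    by apply: cvgB; [exact: cvg_cst|exact: cvg_id].
  by apply: causal_continuous; [exact: cfunP|rewrite subr_gt0].
have ih f g : mu.-integrable [set: R] (EFin \o (fun s => f s * g (T - s))).
  by apply: integrable_convolution; exact: cfunP.
have sE n f g s : f s * iter n mul1X g (T - s) = (1 + (T - s)) ^+ n * (f s * g (T - s)).
  by rewrite iter_mul1XE mulrCA.
apply: (@eq0_of_bounded_moments R h (fun s => 1 + (T - s)) T 0 (1 + T)) => //.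
- apply: (@integrableS _ _ _ mu [set: R]) => //.
  by apply: integrable_add => //; exact: ih.
- move=> s s0 sT; apply: continuousD; apply: continuousM; try exact: cT.
    exact: causal_continuous (cfunP f1) s0.
  exact: causal_continuous (cfunP f2) s0.
- by apply: measurable_funD => //; exact: measurable_subl.
- by move=> s s0 sT; apply/andP; split; lra.
- by move=> s s' _ ss' _; lra.
- move=> n; rewrite (_ : \int[mu]_(x in _) _ = 0) ?normr0//.
  transitivity (conv f1 (iter n mul1X g1) T + conv f2 (iter n mul1X g2) T); last first.
    exact: (congr1 (fun f => cfun f T) (H n)).
  rewrite /conv -RintegralD//.
  rewrite [LHS]Rintegral_mkcond; apply: eq_Rintegral => s _.
  rewrite !sE -mulrDr patchE; case: ifPn => // /negP sT.
  suff -> : f1 s * g1 (T - s) + f2 s * g2 (T - s) = 0 by rewrite mulr0.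
  have [s0|s0] := leP s 0.
    by rewrite (causal_le0 (cfunP f1) s0) (causal_le0 (cfunP f2) s0) !mul0r addr0.
  have [Ts|Ts] := leP T s; last first.
    by exfalso; apply: sT; rewrite inE/= in_itv/= s0.
  have Ts0 : T - s <= 0 by rewrite subr_le0.
  by rewrite (causal_le0 (cfunP g1) Ts0) (causal_le0 (cfunP g2) Ts0) !mulr0 addr0.
- by rewrite /T ltrDl.
Qed.

Theorem titchmarsh u v : J u * J v = 0 -> u = 0 \/ v = 0.
Proof.
move=> uv0.
have uvn n : vmul u (iter n mul1X v.1, iter n mul1X v.2) = 0.
  by apply: J_inj; rewrite JM J_mul_iter.
have re a b : 0 < a -> 0 < b -> u.1 a * v.1 b = u.2 a * v.2 b.
  move=> a0 b0; have H n : cmul u.1 (iter n mul1X v.1) + cmul (- u.2) (iter n mul1X v.2) = 0.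
    by rewrite cmulNl; exact: (congr1 fst (uvn n)).
  have := pointwise_eq0_of_moments H a0 b0.
  by rewrite cfunN mulNr => /eqP; rewrite subr_eq0 => /eqP.
have im a b : 0 < a -> 0 < b -> u.1 a * v.2 b + u.2 a * v.1 b = 0.
  by apply: pointwise_eq0_of_moments => n; exact: (congr1 snd (uvn n)).
have [ne|] := pselect (exists2 a, 0 < a & u.1 a ^+ 2 + u.2 a ^+ 2 != 0).
  right; have [a a0 ua] := ne.
  have v0 b : 0 < b -> v.1 b = 0 /\ v.2 b = 0.
    (* Multiply the pointwise equation [u a * v b = 0] by the conjugate of [u a]. *)
    move=> b0; split; apply: (mulfI ua); rewrite mulr0.
      have -> : (u.1 a ^+ 2 + u.2 a ^+ 2) * v.1 b = u.1 a * (u.1 a * v.1 b - u.2 a * v.2 b) +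
        u.2 a * (u.1 a * v.2 b + u.2 a * v.1 b) by ring.
      by rewrite im// re// subrr !mulr0 addr0.
    have -> : (u.1 a ^+ 2 + u.2 a ^+ 2) * v.2 b = u.1 a * (u.1 a * v.2 b + u.2 a * v.1 b) -
        u.2 a * (u.1 a * v.1 b - u.2 a * v.2 b) by ring.
    by rewrite im// re// subrr !mulr0 subr0.
  by rewrite [v]surjective_pairing; congr (_, _); apply: cfun_eq0 => b /v0[].
move=> ne; left.
have u0 a : 0 < a -> u.1 a = 0 /\ u.2 a = 0.
  move=> a0; have : u.1 a ^+ 2 + u.2 a ^+ 2 = 0.
    by apply/eqP/negP => /negP ua; apply: ne; exists a.
  by move=> /eqP; rewrite paddr_eq0 ?sqr_ge0// !sqrf_eq0 => /andP[/eqP -> /eqP ->].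
by rewrite [u]surjective_pairing; congr (_, _); apply: cfun_eq0 => b /u0[].
Qed.

End Titchmarsh.

(** * Complex-valued functions *)

Section ComplexFunctions.
Context {R : realType}.
Local Open Scope complex_scope.
Local Notation mu := (@lebesgue_measure R).
Local Notation C := (cplx (causal_ring R)).
Implicit Types (h k : R -> R) (u v w f g : R -> R[i]).

Definition pos h : R -> R := fun t => if 0 < t then h t else 0.

Lemma pos_gt0 h t : 0 < t -> pos h t = h t.
Proof. by rewrite /pos => ->. Qed.

Lemma continuous_max0 : continuous (fun t : R => Num.max 0 t).
Proof.
move=> t; under eq_fun do rewrite maxr_absE.
apply: cvgM; last exact: cvg_cst.
apply: cvgD; first by apply: cvgD; [exact: cvg_cst|exact: cvg_id].
by apply: cvg_norm; apply: cvgB; [exact: cvg_cst|exact: cvg_id].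
Qed.

Lemma continuous_extend0 h : {within `[0, +oo[, continuous h} ->
  continuous (fun t : R => h (Num.max 0 t)).
Proof.
move=> /subspace_continuousP ch t.
have m0 (s : R) : `[0, +oo[%classic (Num.max 0 s).
  by rewrite /= in_itv/= andbT le_max lexx.
apply: cvg_trans (ch _ (m0 t)) => P hP.
have H : nbhs t ((fun s : R => Num.max 0 s) @^-1`
    (fun y : R => y \in `[0, +oo[ -> P (h y))) := @continuous_max0 t _ hP.
by apply: filterS H => s; apply; exact: m0.
Qed.

Lemma re_mul (a b : R[i]) :
  complex.Re (a * b) = complex.Re a * complex.Re b - complex.Im a * complex.Im b.
Proof. by case: a => ? ?; case: b. Qed.

Lemma im_mul (a b : R[i]) :
  complex.Im (a * b) = complex.Re a * complex.Im b + complex.Im a * complex.Re b.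
Proof. by case: a => ? ?; case: b. Qed.

Lemma complex_ext (a b : R[i]) :
  complex.Re a = complex.Re b -> complex.Im a = complex.Im b -> a = b.
Proof. by case: a => ? ?; case: b => ? ? /= -> ->. Qed.

Lemma re_add (a b : R[i]) : complex.Re (a + b) = complex.Re a + complex.Re b.
Proof. by case: a => ? ?; case: b. Qed.

Lemma im_add (a b : R[i]) : complex.Im (a + b) = complex.Im a + complex.Im b.
Proof. by case: a => ? ?; case: b. Qed.

Lemma Cm1_causal u : Cm1 u -> causal (pos (repart u)) /\ causal (pos (impart u)).
Proof.
move=> [p p0 [f1 [cre cim] uE]]; split.
  exists p, (fun t : R => repart f1 (Num.max 0 t)); split => //; first exact: continuous_extend0.
  apply/funext => t; rewrite /pos /pw; case: ifPn => // t0.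
  by rewrite max_r ?ltW// /repart uE// re_mul/= mul0r subr0.
exists p, (fun t : R => impart f1 (Num.max 0 t)); split => //; first exact: continuous_extend0.
apply/funext => t; rewrite /pos /pw; case: ifPn => // t0.
by rewrite max_r ?ltW// /impart uE// im_mul/= mul0r addr0.
Qed.

(** The two components may come with different exponents; both are lowered to the smaller one. *)
Lemma causal_Cm1 u : causal (pos (repart u)) -> causal (pos (impart u)) -> Cm1 u.
Proof.
have lower (p q : R) a : p <= q -> continuous a ->
    exists2 a', continuous a' & pw q a = pw p a'.
  move=> pq ca; rewrite (pw_le _ pq).
  exists (fun t : R => (Num.max 0 t) `^ (q - p) * a t) => // x.
  by apply: cvgM; [apply: continuous_maxr_powR; rewrite subr_ge0|exact: ca].
move=> [p [a [p0 ca reE]]] [q [b [q0 cb imE]]].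
pose r := Num.min p q.
have r0 : 0 < r by rewrite lt_min p0.
have rp : r <= p by rewrite ge_min lexx.
have rq : r <= q by rewrite ge_min lexx orbT.
have [a' ca' aE] := lower r p a rp ca.
have [b' cb' bE] := lower r q b rq cb.
exists r => //; exists (fun t => a' t +i* b' t).
  by split; exact: continuous_subspaceT.
move=> t t0; apply: complex_ext; rewrite ?re_mul ?im_mul/= mul0r ?subr0 ?addr0.
  by have := congr1 (@^~ t) reE; rewrite aE /pos /pw t0.
by have := congr1 (@^~ t) imE; rewrite bE /pos /pw t0.
Qed.

(* [insubd] returns the junk value 0 when [pos h] is not causal. *)
Definition to_cfun h : causal_fun R := insubd 0 (pos h).

Lemma to_cfunE h : causal (pos h) -> cfun (to_cfun h) = pos h.
Proof. by move=> ch; apply: insubdK; exact/causal_predP. Qed.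

(** On [Cm1] this map is additive, turns [lconv] into the ring product and is injective up to
    equality on the positive half line, so that identities between convolutions can be settled by
    [ring]. *)
Definition hat u : C := inj_cplx (to_cfun (repart u), to_cfun (impart u)).

Lemma hat_pos u v : eq_pos u v -> hat u = hat v.
Proof.
move=> uv; congr inj_cplx; congr (_, _); congr insubd; apply/funext => t;
  by rewrite /pos /repart /impart; case: ifPn => // /uv ->.
Qed.

Lemma hat_inj u v : Cm1 u -> Cm1 v -> hat u = hat v -> eq_pos u v.
Proof.
move=> /Cm1_causal[ur ui] /Cm1_causal[vr vi] /J_inj[re im] t t0.
apply: complex_ext.
  have := congr1 (fun h : causal_fun R => h t) re.
  by rewrite /= !to_cfunE// !pos_gt0.
have := congr1 (fun h : causal_fun R => h t) im.
by rewrite /= !to_cfunE// !pos_gt0.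
Qed.

Lemma Cm1_pos u v : eq_pos u v -> Cm1 u -> Cm1 v.
Proof. by move=> uv [p p0 [f1 cf1 uE]]; exists p => //; exists f1 => // t t0; rewrite -uv// uE. Qed.

Lemma pos_add h k : pos (fun t => h t + k t) = (fun t => pos h t + pos k t).
Proof. by apply/funext => t; rewrite /pos; case: ifP => _; rewrite ?addr0. Qed.

Lemma pos_opp h : pos (fun t => - h t) = (fun t => - pos h t).
Proof. by apply/funext => t; rewrite /pos; case: ifP => _; rewrite ?oppr0. Qed.

Lemma repartD u v : repart (fun t => u t + v t) = (fun t => repart u t + repart v t).
Proof. by apply/funext => t; rewrite /repart; case: (u t); case: (v t). Qed.

Lemma impartD u v : impart (fun t => u t + v t) = (fun t => impart u t + impart v t).
Proof. by apply/funext => t; rewrite /impart; case: (u t); case: (v t). Qed.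

Lemma repartN u : repart (fun t => - u t) = (fun t => - repart u t).
Proof. by apply/funext => t; rewrite /repart; case: (u t). Qed.

Lemma impartN u : impart (fun t => - u t) = (fun t => - impart u t).
Proof. by apply/funext => t; rewrite /impart; case: (u t). Qed.

Lemma Cm1D u v : Cm1 u -> Cm1 v -> Cm1 (fun t => u t + v t).
Proof.
move=> /Cm1_causal[ur ui] /Cm1_causal[vr vi]; apply: causal_Cm1.
  by rewrite repartD pos_add; exact: causalD.
by rewrite impartD pos_add; exact: causalD.
Qed.

Lemma Cm1N u : Cm1 u -> Cm1 (fun t => - u t).
Proof.
move=> /Cm1_causal[ur ui]; apply: causal_Cm1.
  by rewrite repartN pos_opp; exact: causal_opp.
by rewrite impartN pos_opp; exact: causal_opp.
Qed.

Lemma to_cfunD h k : causal (pos h) -> causal (pos k) ->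
  to_cfun (fun t => h t + k t) = to_cfun h + to_cfun k.
Proof.
move=> ch ck; apply: val_inj.
change (cfun (to_cfun (fun t => h t + k t)) = cfun (to_cfun h + to_cfun k)).
by rewrite cfunD !to_cfunE// pos_add//; exact: causalD.
Qed.

Lemma to_cfunN h : causal (pos h) -> to_cfun (fun t => - h t) = - to_cfun h.
Proof.
move=> ch; apply: val_inj.
change (cfun (to_cfun (fun t => - h t)) = cfun (- to_cfun h)).
by rewrite cfunN !to_cfunE// pos_opp//; exact: causal_opp.
Qed.

Lemma hatD u v : Cm1 u -> Cm1 v -> hat (fun t => u t + v t) = hat u + hat v.
Proof.
move=> /Cm1_causal[ur ui] /Cm1_causal[vr vi]; rewrite -JD; congr inj_cplx.
by congr (_, _); rewrite ?repartD ?impartD to_cfunD.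
Qed.

Lemma hatN u : Cm1 u -> hat (fun t => - u t) = - hat u.
Proof.
move=> /Cm1_causal[ur ui]; rewrite -JN; congr inj_cplx.
by congr (_, _); rewrite ?repartN ?impartN to_cfunN.
Qed.

Lemma conv_itv h k t : causal h -> causal k ->
  conv h k t = \int[mu]_(x in `]0, t[) (h x * k (t - x)).
Proof.
move=> ch ck; rewrite [RHS]Rintegral_mkcond; apply: eq_Rintegral => x _.
rewrite patchE; case: ifPn => // /negP xt.
have [x0|x0] := leP x 0; first by rewrite (causal_le0 ch x0) mul0r.
have [tx|tx] := leP t x; first by rewrite (causal_le0 ck) ?mulr0// subr_le0.
by exfalso; apply: xt; rewrite inE/= in_itv/= x0.
Qed.

Lemma integrable_itv_convolution h k t : causal h -> causal k ->
  mu.-integrable `]0, t[ (EFin \o (fun x => h x * k (t - x))).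
Proof.
move=> ch ck; apply: (@integrableS _ _ _ mu [set: R]) => //.
exact: integrable_convolution.
Qed.

Lemma re_convolution u v t x : x \in (`]0, t[%classic : set R) ->
  repart (fun tau => u tau * v (t - tau)) x =
  pos (repart u) x * pos (repart v) (t - x) - pos (impart u) x * pos (impart v) (t - x).
Proof.
rewrite inE/= in_itv/= => /andP[x0 xt].
by rewrite /pos x0 subr_gt0 xt /repart re_mul.
Qed.

Lemma im_convolution u v t x : x \in (`]0, t[%classic : set R) ->
  impart (fun tau => u tau * v (t - tau)) x =
  pos (repart u) x * pos (impart v) (t - x) + pos (impart u) x * pos (repart v) (t - x).
Proof.
rewrite inE/= in_itv/= => /andP[x0 xt].
by rewrite /pos x0 subr_gt0 xt /impart im_mul.
Qed.

Lemma Cm1_cintegrable u v t : Cm1 u -> Cm1 v ->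
  cintegrable `]0, t[ (fun tau => u tau * v (t - tau)).
Proof.
move=> /Cm1_causal[ur ui] /Cm1_causal[vr vi]; split.
  apply: (@eq_integrable _ _ _ mu _ _ (EFin \o (fun x => pos (repart u) x * pos (repart v) (t - x) -
      pos (impart u) x * pos (impart v) (t - x)))) => //.
    by move=> x xt; congr EFin; rewrite re_convolution.
  by apply: integrable_sub => //; exact: integrable_itv_convolution.
apply: (@eq_integrable _ _ _ mu _ _ (EFin \o (fun x => pos (repart u) x * pos (impart v) (t - x) +
    pos (impart u) x * pos (repart v) (t - x)))) => //.
  by move=> x xt; congr EFin; rewrite im_convolution.
by apply: integrable_add => //; exact: integrable_itv_convolution.
Qed.

Lemma repart_lconv u v : Cm1 u -> Cm1 v -> repart (lconv u v) =
  (fun t => conv (pos (repart u)) (pos (repart v)) t - conv (pos (impart u)) (pos (impart v)) t).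
Proof.
move=> /Cm1_causal[ur ui] /Cm1_causal[vr vi]; apply/funext => t.
rewrite {1}/repart /lconv/= !conv_itv// -RintegralB//; last 2 first.
- exact: integrable_itv_convolution.
- exact: integrable_itv_convolution.
by apply: eq_Rintegral => x xt; exact: re_convolution.
Qed.

Lemma impart_lconv u v : Cm1 u -> Cm1 v -> impart (lconv u v) =
  (fun t => conv (pos (repart u)) (pos (impart v)) t + conv (pos (impart u)) (pos (repart v)) t).
Proof.
move=> /Cm1_causal[ur ui] /Cm1_causal[vr vi]; apply/funext => t.
rewrite {1}/impart /lconv/= !conv_itv// -RintegralD//; last 2 first.
- exact: integrable_itv_convolution.
- exact: integrable_itv_convolution.
by apply: eq_Rintegral => x xt; exact: im_convolution.
Qed.

Lemma pos_causal h : causal h -> pos h = h.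
Proof.
move=> ch; apply/funext => t; rewrite /pos.
by have [//|t0] := ltP 0 t; rewrite (causal_le0 ch).
Qed.

Lemma Cm1_lconv u v : Cm1 u -> Cm1 v -> Cm1 (lconv u v).
Proof.
move=> cu cv; have [ur ui] := Cm1_causal cu; have [vr vi] := Cm1_causal cv.
apply: causal_Cm1.
  rewrite repart_lconv// pos_causal; apply: causalD; try apply: causal_opp; exact: causal_conv.
rewrite impart_lconv// pos_causal; apply: causalD; exact: causal_conv.
Qed.

Lemma hatM u v : Cm1 u -> Cm1 v -> hat (lconv u v) = hat u * hat v.
Proof.
move=> cu cv; rewrite -JM; congr inj_cplx.
have [ur ui] := Cm1_causal cu; have [vr vi] := Cm1_causal cv.
have cc h k : causal h -> causal k -> causal (pos (conv h k)).
  by move=> ch ck; rewrite pos_causal; exact: causal_conv.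
have mE h k : causal (pos h) -> causal (pos k) ->
    to_cfun (conv (pos h) (pos k)) = cmul (to_cfun h) (to_cfun k).
  move=> ch ck; apply: val_inj.
  change (cfun (to_cfun (conv (pos h) (pos k))) = conv (cfun (to_cfun h)) (cfun (to_cfun k))).
  rewrite (to_cfunE ch) (to_cfunE ck) to_cfunE; last exact: cc.
  by rewrite pos_causal//; exact: causal_conv.
congr (_, _).
  rewrite repart_lconv// to_cfunD ?to_cfunN ?mE//; try exact: cc.
  by rewrite pos_opp; apply: causal_opp; exact: cc.
by rewrite impart_lconv// to_cfunD ?mE//; exact: cc.
Qed.

Lemma hat0 : hat (fun=> 0) = 0.
Proof.
rewrite -J0 /hat; congr inj_cplx; congr (_, _); apply: cfun_eq0 => t t0;
  by rewrite to_cfunE ?pos_gt0// /pos; under eq_fun do rewrite if_same; exact: causal0.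
Qed.

Lemma Cm1_cst (c : R[i]) : Cm1 (fun=> c).
Proof.
exists 1 => //; exists (fun=> c); first by split; apply: continuous_subspaceT => x; exact: cvg_cst.
by move=> t t0; rewrite subrr powRr0 mul1r.
Qed.

Lemma hat_integral_domain u v :
  hat u * hat v = 0 -> hat u = 0 \/ hat v = 0.
Proof. by move=> /titchmarsh[H|H]; [left|right]; rewrite /hat H. Qed.

Lemma lconv1E w : Cm1 w ->
  repart (lconv (fun=> 1) w) = conv heaviside (pos (repart w)) /\
  impart (lconv (fun=> 1) w) = conv heaviside (pos (impart w)).
Proof.
move=> cw; have c1 := Cm1_cst (1 : R[i]).
have re1 : pos (repart (fun=> 1 : R[i])) = heaviside.
  by apply/funext => s; rewrite /pos /heaviside /pw subrr powRr0 mulr1.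
have im1 : pos (impart (fun=> 1 : R[i])) = (fun=> 0).
  by apply/funext => s; rewrite /pos if_same.
have c0 h s : conv (fun=> 0) h s = 0.
  by rewrite /conv; under eq_Rintegral do rewrite mul0r; rewrite /Rintegral integral0.
rewrite repart_lconv// impart_lconv// re1 im1.
by split; apply/funext => s; rewrite c0 ?subr0 ?addr0.
Qed.

Lemma cderive_lconv1 w t : Cm1 w -> 0 < t ->
  cderivable (lconv (fun=> 1) w) t /\ cderive (lconv (fun=> 1) w) t = w t.
Proof.
move=> cw t0; have [wr wi] := Cm1_causal cw; have [reE imE] := lconv1E cw.
have [dr er] := is_derive_conv_heaviside wr t0.
have [di ei] := is_derive_conv_heaviside wi t0.
split; first by rewrite /cderivable reE imE; split; [exact: dr|exact: di].
by rewrite /cderive !derive1E reE imE er ei !pos_gt0//; apply: complex_ext.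
Qed.

Lemma lconv_cst (c : R[i]) u :
  lconv (fun=> c) u = lconv (fun=> 1) (fun t => c * u t).
Proof.
by apply/funext => t; rewrite /lconv; congr cintegral; apply/funext => s; rewrite mul1r.
Qed.

Lemma Cm10_Cm1 u : Cm10 u -> Cm1 u.
Proof. by move=> [p /andP[p0 _] up]; exists p. Qed.

Lemma near_cderivable u v t : 0 < t -> eq_pos u v -> cderivable v t ->
  cderivable u t /\ cderive u t = cderive v t.
Proof.
move=> t0 uv [dr di].
have near_re : {near t, repart v =1 repart u}.
  by near=> s; rewrite /repart uv//; near: s; exact: lt_nbhsr.
have near_im : {near t, impart v =1 impart u}.
  by near=> s; rewrite /impart uv//; near: s; exact: lt_nbhsr.
split; first split.
- exact: near_eq_derivable near_re dr.
- exact: near_eq_derivable near_im di.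
- rewrite /cderive !derive1E; congr (_ +i* _); symmetry.
    exact: near_eq_derive near_re.
  exact: near_eq_derive near_im.
Unshelve. all: by end_near. Qed.

Lemma Cm1_der1_primitive f : Cm1_der 1 f -> [/\ has_limit0 f,
  Cm1 f & hat f = hat (fun=> limit0 f) + hat (fun=> 1) * hat (cderive f)].
Proof.
move=> [df cg]; set g := cderive f in cg *; have [gr gi] := Cm1_causal cg.
have [|cr rE rlim] := @primitive_of_causal R (repart f) (pos (repart g)) gr.
  move=> t t0; have [d _] := df t t0; rewrite pos_gt0//.
  by apply: (DeriveDef d); rewrite /repart /g /= derive1E.
have [|ci iE ilim] := @primitive_of_causal R (impart f) (pos (impart g)) gi.
  move=> t t0; have [_ d] := df t t0; rewrite pos_gt0//.
  by apply: (DeriveDef d); rewrite /impart /g /= derive1E.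
have limE : limit0 f = cr +i* ci.
  by congr (_ +i* _); apply: cvg_lim => //; exact: norm_hausdorff.
have c1 := Cm1_cst (1 : R[i]); have cl := Cm1_cst (limit0 f).
have fE : eq_pos (fun t => limit0 f + lconv (fun=> 1) g t) f.
  move=> t t0; have [reE imE] := lconv1E cg.
  apply: complex_ext.
    by rewrite re_add -[RHS]/(repart f t) rE// -reE limE.
  by rewrite im_add -[RHS]/(impart f t) iE// -imE limE.
split.
- by split; apply/cvg_ex; [exists cr|exists ci].
- by apply: Cm1_pos fE _; apply: Cm1D => //; exact: Cm1_lconv.
- by rewrite -(hat_pos fE) hatD ?hatM//; exact: Cm1_lconv.
Qed.

Lemma Cm1Z (c : R[i]) u : Cm1 u -> Cm1 (fun t => c * u t).
Proof.
move=> [p p0 [f1 [cr ci] uE]]; exists p => //; exists (fun t => c * f1 t).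
  split.
    rewrite (_ : repart _ = (fun t => complex.Re c * repart f1 t - complex.Im c * impart f1 t)).
      move=> x; apply: cvgB; apply: cvgM; [exact: cvg_cst|exact: cr|exact: cvg_cst|exact: ci].
    by apply/funext => t; rewrite /repart re_mul.
  rewrite (_ : impart _ = (fun t => complex.Re c * impart f1 t + complex.Im c * repart f1 t)).
    move=> x; apply: cvgD; apply: cvgM; [exact: cvg_cst|exact: ci|exact: cvg_cst|exact: cr].
  by apply/funext => t; rewrite /impart im_mul.
by move=> t t0; rewrite uE// mulrCA.
Qed.

End ComplexFunctions.

Opaque Cm1 lconv limit0 cderive hat.

(** * Convolution quotients *)

Section Quotients.
Context {R : realType}.
Local Open Scope complex_scope.
Local Notation C := (cplx (causal_ring R)).
Implicit Types (u v w f g k : R -> R[i]) (p q r : (R -> R[i]) * (R -> R[i])).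

Lemma is_fracP p : is_frac p <-> [/\ Cm1 p.1, Cm1 p.2 & hat (p.2) <> 0].
Proof.
split=> -[c1 c2 n0]; split => // H; apply: n0.
  by apply: hat_inj => //; [exact: Cm1_cst|rewrite hat0].
by rewrite (hat_pos H) hat0.
Qed.

Lemma frac_equivP p q : is_frac p -> is_frac q ->
  frac_equiv p q <-> hat (p.1) * hat (q.2) = hat (q.1) * hat (p.2).
Proof.
move=> [p1 p2 _] [q1 q2 _]; rewrite -!hatM//; split; first exact: hat_pos.
by apply: hat_inj; exact: Cm1_lconv.
Qed.

(** Absence of zero divisors is known only on the image of [hat]; hence the difference is formed as
    a function before [hat] is applied. *)
Lemma hat_mulIr u v w : Cm1 u -> Cm1 v -> Cm1 w -> hat w <> 0 ->
  hat u * hat w = hat v * hat w -> hat u = hat v.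
Proof.
move=> cu cv cw w0 H; have cvN := Cm1N cv.
have cuv : Cm1 (fun t => u t + - v t) by exact: Cm1D.
have uvw0 : hat (fun t => u t + - v t) * hat w = 0.
  by rewrite hatD// hatN// mulrDl H mulNr subrr.
have [e|//] := hat_integral_domain uvw0.
by move: e; rewrite hatD// hatN// => /eqP; rewrite subr_eq0 => /eqP.
Qed.

Lemma frac_equiv_trans p q r : is_frac p -> is_frac q -> is_frac r ->
  frac_equiv p q -> frac_equiv q r -> frac_equiv p r.
Proof.
move=> fp fq fr /(frac_equivP fp fq) pq /(frac_equivP fq fr) qr; apply/frac_equivP => //.
have [p1 p2 _] := fp; have [r1 r2 _] := fr; have /is_fracP[q1 q2 q0] := fq.
have c1 := Cm1_lconv p1 r2; have c2 := Cm1_lconv r1 p2.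
rewrite -!hatM//; apply: (hat_mulIr c1 c2 q2 q0).
rewrite !hatM//.
transitivity (hat (p.1) * hat (q.2) * hat (r.2)); first by ring.
rewrite pq; transitivity (hat (q.1) * hat (r.2) * hat (p.2)); first by ring.
by rewrite qr; ring.
Qed.

Lemma frac_equiv_sym p q : frac_equiv p q -> frac_equiv q p.
Proof. by move=> pq t t0; rewrite pq. Qed.

Lemma frac_class_eq p q : is_frac p -> is_frac q -> frac_equiv p q ->
  frac_class p = frac_class q.
Proof.
move=> fp fq pq; apply/seteqP; split => r [fr er]; split => //.
  exact: (frac_equiv_trans fr fp fq er pq).
exact: (frac_equiv_trans fr fq fp er (frac_equiv_sym pq)).
Qed.

Lemma mem_frac_class p : is_frac p -> frac_class p p.
Proof. by move=> fp; split => // t t0. Qed.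

Lemma is_frac_den p q : is_frac p -> is_frac q -> hat (lconv p.2 q.2) <> 0.
Proof.
move=> /is_fracP[_ p2 p0] /is_fracP[_ q2 q0]; rewrite hatM// => H.
by have [] := hat_integral_domain H.
Qed.

Lemma is_frac_mul p q : is_frac p -> is_frac q -> is_frac (frac_mul p q).
Proof.
move=> fp fq; have [p1 p2 _] := fp; have [q1 q2 _] := fq.
by apply/is_fracP; split; [exact: Cm1_lconv|exact: Cm1_lconv|exact: is_frac_den].
Qed.

Lemma is_frac_add p q : is_frac p -> is_frac q -> is_frac (frac_add p q).
Proof.
move=> fp fq; have [p1 p2 _] := fp; have [q1 q2 _] := fq.
apply/is_fracP; split; last exact: is_frac_den; last exact: Cm1_lconv.
by apply: Cm1D; exact: Cm1_lconv.
Qed.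

Lemma is_frac_opp p : is_frac p -> is_frac (frac_opp p).
Proof. by move=> [p1 p2 p0]; split => //; exact: Cm1N. Qed.

(** One inclusion takes [p] and [q] as their own representatives; the other is the independence of
    the product class from the representatives. *)
Lemma Fmul_class p q : is_frac p -> is_frac q ->
  Fmul (frac_class p) (frac_class q) = frac_class (frac_mul p q).
Proof.
move=> fp fq; apply/seteqP; split => [r H|r H p' [fp' ep] q' [fq' eq]].
  by apply: H; exact: mem_frac_class.
have f1 := is_frac_mul fp fq; have f2 := is_frac_mul fp' fq'.
rewrite (frac_class_eq f2 f1); first exact: H.
apply/(frac_equivP f2 f1).
have [? ? _] := fp; have [? ? _] := fq; have [? ? _] := fp'; have [? ? _] := fq'.
move: ep eq => /(frac_equivP fp' fp) ep /(frac_equivP fq' fq) eq.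
rewrite /frac_mul/= !hatM//.
transitivity ((hat (p'.1) * hat (p.2)) * (hat (q'.1) * hat (q.2))); first by ring.
by rewrite ep eq; ring.
Qed.

Lemma Fadd_class p q : is_frac p -> is_frac q ->
  Fadd (frac_class p) (frac_class q) = frac_class (frac_add p q).
Proof.
move=> fp fq; apply/seteqP; split => [r H|r H p' [fp' ep] q' [fq' eq]].
  by apply: H; exact: mem_frac_class.
have f1 := is_frac_add fp fq; have f2 := is_frac_add fp' fq'.
rewrite (frac_class_eq f2 f1); first exact: H.
apply/(frac_equivP f2 f1).
have [? ? _] := fp; have [? ? _] := fq; have [? ? _] := fp'; have [? ? _] := fq'.
move: ep eq => /(frac_equivP fp' fp) ep /(frac_equivP fq' fq) eq.
rewrite /frac_add/= !hatD ?hatM//; try exact: Cm1_lconv.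
transitivity ((hat (p'.1) * hat (p.2)) * (hat (q'.2) * hat (q.2)) +
  (hat (q'.1) * hat (q.2)) * (hat (p'.2) * hat (p.2))); first by ring.
by rewrite ep eq; ring.
Qed.

Lemma Fopp_class p : is_frac p -> Fopp (frac_class p) = frac_class (frac_opp p).
Proof.
move=> fp; apply/seteqP; split => [r H|r H p' [fp' ep]].
  by apply: H; exact: mem_frac_class.
have f1 := is_frac_opp fp; have f2 := is_frac_opp fp'.
rewrite (frac_class_eq f2 f1); first exact: H.
apply/(frac_equivP f2 f1).
have [? ? _] := fp; have [? ? _] := fp'.
move: ep => /(frac_equivP fp' fp) ep.
by rewrite /frac_opp/= !hatN// !mulNr ep.
Qed.

Lemma caputoE k f : Cm1 k -> Cm1_der 1 f ->
  caputo_exists k f /\ eq_pos (caputo k f) (lconv k (cderive f)).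
Proof.
move=> ck df; have [hl cf fE] := Cm1_der1_primitive df.
have [_ cg] := df; set g := cderive f in cg fE *.
have c1 := Cm1_cst (1 : R[i]); have cl := Cm1_cst (limit0 f).
have ckg := Cm1_lconv ck cg.
have clk := Cm1Z (limit0 f) ck.
pose w t := limit0 f * k t + lconv k g t.
have cw : Cm1 w by exact: Cm1D.
have E : eq_pos (lconv k f) (lconv (fun=> 1) w).
  apply: hat_inj; [exact: Cm1_lconv..|].
  rewrite (hatM ck cf) (hatM c1 cw) fE (hatD clk ckg) (hatM ck cg) !mulrDr.
  (* Complex scalars do not act on the ring, so the multiple [limit0 f * k] is handled through its
     primitive, the convolution of the constant function with [k]. *)
  rewrite -[X in _ = X + _](hatM c1 clk) -lconv_cst (hatM cl ck).
  ring.
have D t : 0 < t -> cderivable (lconv k f) t /\ cderive (lconv k f) t = w t.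
  move=> t0; have [d1 d2] := cderive_lconv1 cw t0.
  by have [? ->] := near_cderivable t0 E d1.
split; first (split; first exact: hl; move=> t t0).
  by split; [exact: Cm1_cintegrable|exact: (D t t0).1].
move=> t t0; rewrite /caputo (D t t0).2 /w addrC addrA addNr add0r.
by [].
Qed.

End Quotients.

Theorem theorem4p2 (R : realType) (kappa k f : R -> complex R) :
  Sonine_pair kappa k ->
  Cm1_der 1 f ->
  [/\ caputo_exists k f,
      Cm1 (caputo k f),
      Fm1 (embed kappa (caputo k f)) &
      embed kappa (caputo k f) = alg_caputo kappa f].
Proof.
move=> [/Cm10_Cm1 cK /Cm10_Cm1 ck Kk] df.
have [ex cE] := caputoE ck df.
have [_ cf fE] := Cm1_der1_primitive df; have [_ cg] := df.
set g := cderive f in fE cg cE.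
have ckg := Cm1_lconv ck cg.
have cc : Cm1 (caputo k f) by apply: Cm1_pos ckg => t t0; rewrite cE.
have c1 := Cm1_cst (1 : complex R); have cl := Cm1_cst (limit0 f).
have Kk1 : hat kappa * hat k = hat (fun=> 1).
  by rewrite -hatM//; exact: hat_pos.
have K0 : hat kappa <> 0.
  (* Otherwise the Sonine condition would make the constant functions [1] and [0] agree on the
     positive half line. *)
  move=> K0; have /(hat_inj c1 (Cm1_cst 0)) : hat (fun=> 1 : complex R) = hat (fun=> 0).
    by rewrite hat0 -Kk1 K0 mul0r.
  by move=> /(_ 1 ltr01)/eqP; rewrite oner_eq0.
have fS : is_frac (kappa, lconv kappa kappa).
  apply/is_fracP; split => //; first exact: Cm1_lconv.
  by rewrite /= hatM// => H; have [] := hat_integral_domain H.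
have fe h : Cm1 h -> is_frac (lconv h kappa, kappa).
  by move=> ch; apply/is_fracP; split => //; exact: Cm1_lconv.
split; [exact: ex|exact: cc| |].
  by exists (lconv (caputo k f) kappa, kappa) => //; exact: fe.
rewrite /alg_caputo /Fsub /Sinv /embed; clearbody g.
move: (fun=> limit0 f) cl fE => c cl fE.
have m1 := is_frac_mul fS (fe f cf); have m2 := is_frac_mul fS (fe _ cl).
have m3 := is_frac_opp m2.
(* The field operations are evaluated on explicit representatives, which leaves the equivalence of
   two fractions. *)
apply: etrans (esym (etrans (congr2 (@Fadd R) (Fmul_class fS (fe f cf)) (etrans
  (congr1 (@Fopp R) (Fmul_class fS (fe _ cl))) (Fopp_class m2))) (Fadd_class m1 m3))).
apply: (frac_class_eq (fe _ cc) (is_frac_add m1 m3)).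
apply/(frac_equivP (fe _ cc) (is_frac_add m1 m3)).
have cKK := Cm1_lconv cK cK; have cKKK := Cm1_lconv cKK cK.
(* This is the denominator of both products with [S_kappa]. *)
have eKKK : hat (lconv (lconv kappa kappa) kappa) = hat kappa ^+ 3.
  by rewrite (hatM cKK cK) (hatM cK cK) !exprS expr0 mulr1 mulrA.
have cN u : Cm1 u -> Cm1 (lconv kappa (lconv u kappa)).
  by move=> cu; exact: Cm1_lconv cK (Cm1_lconv cu cK).
have eN u : Cm1 u -> hat (lconv kappa (lconv u kappa)) = hat u * hat kappa ^+ 2.
  by move=> cu; rewrite (hatM cK (Cm1_lconv cu cK)) (hatM cu cK); ring.
have e1 : hat (lconv (caputo k f) kappa) = hat k * hat g * hat kappa.
  by rewrite (hatM cc cK) (hat_pos cE) (hatM ck cg).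
have e2 : hat (frac_add (frac_mul (kappa, lconv kappa kappa) (lconv f kappa, kappa))
    (frac_opp (frac_mul (kappa, lconv kappa kappa) (lconv c kappa, kappa)))).1 =
    hat f * hat kappa ^+ 2 * hat kappa ^+ 3 + - (hat c * hat kappa ^+ 2) * hat kappa ^+ 3.
  apply: etrans (hatD (Cm1_lconv (cN f cf) cKKK) (Cm1_lconv (Cm1N (cN c cl)) cKKK)) _.
  apply: congr2; apply: etrans (hatM _ cKKK) _; first exact: cN.
  - by rewrite eKKK eN.
  - exact: Cm1N (cN c cl).
  - by rewrite eKKK hatN ?eN//; exact: cN.
apply: etrans (congr2 *%R e1 (hatM cKKK cKKK)) _.
apply: etrans _ (esym (congr1 ( *%R^~ (hat kappa)) e2)).
(* As [f - c] is [kappa * k * g] in the ring, both cross products equal [k * g * kappa ^ 7]. *)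
by rewrite eKKK fE -Kk1; ring.
Qed.
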